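(* For all $\mu>0$ and $L$ there is a $K$ such that the following holds. Let $P$ be a finite poset and $(A,B)$ a maximal $\mu$-pair in $P$ with $|B|\ge\max\{\mu|A|,K\}$. Then $\sum_{x\in A}\sigma^2(x)\ge L|A|$.
   Context: For a finite poset $P$, $f$ is a uniformly random linear extension (order-preserving bijection $P\to[|P|]$), and $\sigma(x)$ is the standard deviation of $f(x)$. For disjoint $A,B\subseteq P$, the pair $(A,B)$ is incomparable if no $a\in A$ is comparable to any $b\in B$. An incomparable pair $(A,B)$ is a $\mu$-pair ($\mu$-near maximum) if $|A||B|\ge\mu|C||D|$ for every incomparable pair $(C,D)$ in $P$. A $\mu$-pair $(A,B)$ is maximal if there is no other $\mu$-pair $(A',B')$ with $A\subseteq A'$ and $B\subseteq B'$. *)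

(* Defs.v *)
From HB Require Import structures.
From mathcomp Require Import all_boot all_order all_algebra.
From mathcomp Require Import all_classical all_reals.

Set Implicit Arguments.
Unset Strict Implicit.
Unset Printing Implicit Defensive.

Import Order.TTheory GRing.Theory Num.Theory.
Local Open Scope ring_scope.

Section LinearExtensions.
Variables (d : Order.disp_t) (P : finPOrderType d).

(* An injection between finite types of the same cardinality is a bijection,
   see linear_extensionP. *)
Definition linear_extension (f : {ffun P -> 'I_#|P|}) : bool :=
  injectiveb f && [forall x, forall y, (x <= y)%O ==> (f x <= f y)%N].

Lemma linear_extensionP (f : {ffun P -> 'I_#|P|}) :
  reflect (bijective f /\ {homo f : x y / (x <= y)%O >-> (x <= y)%N})
          (linear_extension f).
Proof.
apply: (iffP andP) => -[fI fH]; split.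
- by apply: inj_card_bij; [exact/injectiveP | rewrite card_ord].
- by move=> x y; move/forallP: fH => /(_ x) /forallP /(_ y) /implyP.
- exact/injectiveP/bij_inj.
- by apply/forallP => x; apply/forallP => y; apply/implyP => /fH.
Qed.

Variable R : realType.

Definition linext_mean (X : {ffun P -> 'I_#|P|} -> R) : R :=
  (\sum_(f | linear_extension f) X f) / #|linear_extension|%:R.

(* 'I_n is {0, ..., n - 1}, whence the successor to land in [n]. *)
Definition position (x : P) (f : {ffun P -> 'I_#|P|}) : R := (f x).+1%:R.

Definition sigma (x : P) : R :=
  Num.sqrt (linext_mean
    (fun f => (position x f - linext_mean (position x)) ^+ 2)).

End LinearExtensions.

Arguments position {d P} R x f.
Arguments sigma {d P} R x.

Section NearMaximumPairs.
Variables (d : Order.disp_t) (P : finPOrderType d) (R : realType).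

Definition incomparable_pair (A B : {set P}) : Prop :=
  [disjoint A & B] /\ {in A & B, forall a b, ~~ (a >=< b)%O}.

Definition mu_pair (mu : R) (A B : {set P}) : Prop :=
  incomparable_pair A B /\
  forall C D : {set P}, incomparable_pair C D ->
    mu * (#|C|%:R * #|D|%:R) <= #|A|%:R * #|B|%:R.

Definition maximal_mu_pair (mu : R) (A B : {set P}) : Prop :=
  mu_pair mu A B /\
  ~ exists A' B' : {set P},
      [/\ mu_pair mu A' B', (A', B') <> (A, B), A \subset A' & B \subset B'].

End NearMaximumPairs.

(* Main.v *)
(** Condition a uniform linear extension on its restriction to the down-closure
  [X] of [A] and on its restriction to the complement of [X]. What remains is a
  uniform nondecreasing sequence [Y i], the number of elements outside [X] below
  the [i]-th element of [X], subject to [Y i <= k i] only: [X] is a down-set, so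
  all constraints have the same direction. The tail of [X] from index [i] on is
  incomparable to the first [k i] elements outside [X], so near-maximality
  gives [mu * (p + 1 - i) * k i <= |A| |B|].

  Reflecting a single [Y i] in its range of values shows that [i |-> E (Y i)] is
  convex, with second difference [E (Y (i+1) - k i)^+]. Hence its slope is of
  order [|B| / |A|] at most elements of [A], provided that [B] is not mostly
  above [A]; else pass to the dual poset. If [|B| / |A|] is large, one site
  already fluctuates enough. Otherwise [|A|] is large, and the second differences
  have a bounded sum, so the barrier is rarely met in a typical window of bounded
  length. In a window where it is not met, covariances are harmonic off the
  diagonal, and the variance is at least proportional to the length of the window. *)

Require Import Defs.
From mathcomp Require Import all_boot all_order all_algebra.
From mathcomp Require Import all_classical all_reals.
From mathcomp Require Import zify ring lra.

Set Implicit Arguments.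
Unset Strict Implicit.
Unset Printing Implicit Defensive.

Import Order.TTheory GRing.Theory Num.Theory.
Local Open Scope ring_scope.

(** Resampling a site inside a window needs a conditioning event that the site does not influence.
    That no overshoot occurs is not such an event; that the right end of the path is at most the
    left end of the barrier is one. Its failure need not produce an overshoot, whereas second
    differences measure overshoots only. The bridge is a map that pushes a path of bounded rise up
    to one that overshoots. It is at most exponentially many to one in the length of the window,
    which is harmless because that length is bounded in terms of [mu] and [L] before |A| is taken
    large. Restricting to bounded rise is possible in an argument by contradiction: small variances
    at both ends bound the second moment of the rise. Convexity alone would allow the mean to stay
    flat and to jump at the last sites. The mean of the path truncated at a fixed level is concave
    where the barrier is above that level, and this forces a linear rise. *)

(* Hypotheses over a field slow [lia] down. *)
Ltac nat_lia :=
  repeat match goal with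
  | H : ?P |- _ =>
      lazymatch type of P with
      | Prop => lazymatch P with
                | is_true (leq _ _) => fail
                | is_true (andb _ _) => fail
                | is_true (negb _) => fail
                | @eq nat _ _ => fail
                | _ => clear H
                end
      end
  end; lia.

Lemma count_window (P : pred nat) (a b c l : nat) :
  (forall i, (a <= i < b)%N -> P i -> (c <= i < c + l)%N) ->
  (count P (index_iota a b) <= l)%N.
Proof.
move=> H; rewrite -size_filter -[leqRHS](size_iota c l).
apply: uniq_leq_size => [|i]; first by rewrite filter_uniq ?iota_uniq.
by rewrite mem_filter mem_index_iota mem_iota => /andP[Pi /H]; apply.
Qed.

Lemma count_le_split (T : Type) (A B : pred T) (s : seq T) :
  (count A s <= count (predI A B) s + count (predC B) s)%N.
Proof. by elim: s => //= x s IH; case: (A x); case: (B x) => /=; lia. Qed.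

(** Markov's inequality in counting form. *)
Lemma count_mul_le_sum (R : realFieldType) (T : eqType) (A B : pred T) (s : seq T)
    (F : T -> R) (c : R) :
  (forall i, 0 <= F i) -> (forall i, i \in s -> B i -> c <= F i) ->
  (count (predI A B) s)%:R * c <= \sum_(i <- s | A i) F i.
Proof.
move=> F0; elim: s => [|x s IH] H /=; first by rewrite big_nil mul0r.
have {IH}IH := IH (fun i si => H i (mem_behead (s := x :: s) si)).
rewrite big_cons; case: (A x) => //=; case: (boolP (B x)) => [Bx|_] /=.
  by rewrite natrD mulrDl mul1r lerD // H ?mem_head.
by rewrite add0n; apply: (le_trans IH); rewrite lerDr.
Qed.

(** * Paths under a barrier *)

Section LatticePaths.
Variables (p q : nat) (k : nat -> nat).

(* [g i] stands for the number of elements of a chain of size [q] that precede the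
   [i]-th element of a chain of size [p]. The indices [0] and beyond [p] are a
   convention, which provides every site with two neighbours. *)
Definition admissible (g : nat -> nat) : Prop :=
  [/\ g 0 = 0%N, {homo g : i j / (i <= j)%N}, forall i, (g i <= k i)%N
    & forall i, (p < i)%N -> g i = q].

Definition set_at (g : nat -> nat) (j v : nat) : nat -> nat :=
  fun l => if l == j then v else g l.

(** The largest value that site [i.+1] can take when the other sites are kept. Here and in the
    operators below, [i] names the left neighbour of the site that moves. *)
Definition ceiling (g : nat -> nat) (i : nat) : nat := minn (g i.+2) (k i.+1).

Definition reflect_at (i : nat) (g : nat -> nat) : nat -> nat :=
  set_at g i.+1 (g i + ceiling g i - g i.+1)%N.

(** A cyclic shift by half of the range. Unlike reflection, which fixes the midpoint, it moves every
    value by at least half the width of the range. *)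
Definition rotate_at (i : nat) (g : nat -> nat) : nat -> nat :=
  let len := (ceiling g i - g i).+1%N in
  set_at g i.+1 (g i + (g i.+1 - g i + len./2) %% len)%N.

Lemma set_at_other (g : nat -> nat) (j v l : nat) :
  l != j -> set_at g j v l = g l.
Proof. by rewrite /set_at => /negPf ->. Qed.

Lemma set_at_same (g : nat -> nat) (j v : nat) : set_at g j v j = v.
Proof. by rewrite /set_at eqxx. Qed.

Lemma set_at_set_at (g : nat -> nat) (j v w : nat) :
  set_at (set_at g j v) j w = set_at g j w.
Proof. by apply/funext => l; rewrite /set_at; case: eqP. Qed.

Lemma set_at_id (g : nat -> nat) (j : nat) : set_at g j (g j) = g.
Proof. by apply/funext => l; rewrite /set_at; case: eqP => // ->. Qed.

Lemma ceiling_set_at (g : nat -> nat) (i v : nat) :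
  ceiling (set_at g i.+1 v) i = ceiling g i.
Proof. by rewrite /ceiling set_at_other //; apply/eqP; lia. Qed.

Lemma floor_set_at (g : nat -> nat) (i v : nat) : set_at g i.+1 v i = g i.
Proof. by rewrite set_at_other //; apply/eqP; lia. Qed.

Lemma admissible_site (g : nat -> nat) (i : nat) :
  admissible g -> (g i <= g i.+1)%N /\ (g i.+1 <= ceiling g i)%N.
Proof.
by case=> _ gH gk _; split; rewrite ?gH // /ceiling leq_min gk gH.
Qed.

Lemma admissible_set_at (g : nat -> nat) (i v : nat) :
  admissible g -> (i < p)%N -> (g i <= v)%N -> (v <= ceiling g i)%N ->
  admissible (set_at g i.+1 v).
Proof.
case=> g0 gH gk gp ip; rewrite /ceiling leq_min => vl /andP[vr vk].
split=> [|a b ab|l|l pl]; rewrite /set_at //.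
- case: (a =P i.+1) => [ai|ai]; case: (b =P i.+1) => [bi|bi] //.
  + by apply: leq_trans vr (gH _ _ _); lia.
  + by apply: leq_trans (gH _ _ _) vl; lia.
  + exact: gH.
- by case: eqP => [->|].
- by case: eqP => [li|_]; [lia | exact: gp].
Qed.

Lemma admissible_reflect (g : nat -> nat) (i : nat) :
  (i < p)%N -> admissible g -> admissible (reflect_at i g).
Proof.
move=> ip ga; have [l1 l2] := admissible_site i ga.
by apply: admissible_set_at => //; lia.
Qed.

Lemma reflect_inj (g h : nat -> nat) (i : nat) :
  admissible g -> admissible h -> reflect_at i g = reflect_at i h -> g = h.
Proof.
move=> ga ha; rewrite /reflect_at => E.
have [g1 g2] := admissible_site i ga; have [h1 h2] := admissible_site i ha.
have Ei : g i = h i by rewrite -(floor_set_at g i (g i + ceiling g i - g i.+1)%N) E floor_set_at.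
have Ec : ceiling g i = ceiling h i.
  by rewrite -(ceiling_set_at g i (g i + ceiling g i - g i.+1)%N) E ceiling_set_at.
have := congr1 (fun u => u i.+1) E; rewrite !set_at_same => Ev.
rewrite -(set_at_id g i.+1) -(set_at_id h i.+1).
rewrite -(set_at_set_at g _ (g i + ceiling g i - g i.+1)%N) E set_at_set_at.
by congr set_at; lia.
Qed.

Lemma rotate_bounds (a b v : nat) (len := (b - a).+1%N) :
  (a <= v <= b)%N ->
  let v' := (a + (v - a + len./2) %% len)%N in
  [/\ (a <= v')%N, (v' <= b)%N &
   (v' = v + len./2 \/ v' + (len - len./2) = v)%N].
Proof.
move=> /andP[av vb] /=.
have hl : (len./2 <= len)%N by rewrite /len; lia.
have [sm|lg] := ltnP (v - a + len./2) len.
  by rewrite modn_small //; split; rewrite /len in sm *; lia.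
have -> : (v - a + len./2 = (v - a + len./2 - len) + len)%N by lia.
rewrite modnDr modn_small; last by rewrite /len in lg *; lia.
by split; rewrite /len in lg *; lia.
Qed.

Lemma admissible_rotate (g : nat -> nat) (i : nat) :
  (i < p)%N -> admissible g -> admissible (rotate_at i g).
Proof.
move=> ip ga; have [l1 l2] := admissible_site i ga.
have [|r1 r2 _] := @rotate_bounds (g i) (ceiling g i) (g i.+1); first lia.
by apply: admissible_set_at.
Qed.

Lemma rotate_inj (g h : nat -> nat) (i : nat) :
  admissible g -> admissible h -> rotate_at i g = rotate_at i h -> g = h.
Proof.
move=> ga ha; rewrite /rotate_at /= => E.
have [g1 g2] := admissible_site i ga; have [h1 h2] := admissible_site i ha.
set v := (X in set_at g _ X = _) in E; set w := (X in _ = set_at h _ X) in E.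
have Ei : g i = h i by rewrite -(floor_set_at g i v) E floor_set_at.
have Ec : ceiling g i = ceiling h i.
  by rewrite -(ceiling_set_at g i v) E ceiling_set_at.
have Ev : v = w by have := congr1 (fun u => u i.+1) E; rewrite !set_at_same.
rewrite -(set_at_id g i.+1) -(set_at_id h i.+1).
rewrite -(set_at_set_at g _ v) E set_at_set_at; congr set_at.
have [|_ _] := @rotate_bounds (g i) (ceiling g i) (g i.+1); first lia.
have [|_ _] := @rotate_bounds (h i) (ceiling h i) (h i.+1); first lia.
rewrite -/v -/w -Ei -Ec -Ev; move: g1 g2 h1 h2; rewrite -Ei -Ec.
clear Ei Ec; clearbody v w; clear E Ev ga ha.
move: (g i) (ceiling g i) (g i.+1) (h i.+1) v => a b x z u ax xb az zb.
move: ((b - a).+1./2) (erefl (b - a).+1./2) => l /esym ll.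
by case=> ?; case=> ?; lia.
Qed.

End LatticePaths.

(* Functions on [nat] do not form a finite type: sums over paths run over [Om]. *)
Definition parametrizes (W : finType) (Om : {set W}) (Y : W -> nat -> nat)
    (p q : nat) (k : nat -> nat) : Prop :=
  [/\ (0 < #|Om|)%N, forall w, w \in Om -> admissible p q k (Y w),
      {in Om &, injective Y}
    & forall g, admissible p q k g -> exists2 w, w \in Om & Y w = g].

(** * Uniform random paths: moves at one site, means and slopes *)

Section Expectation.
Variables (R : realType) (W : finType) (Om : {set W}) (Y : W -> nat -> nat).
Variables (p q : nat) (k : nat -> nat).
Hypothesis Y_par : parametrizes Om Y p q k.
Hypothesis k_mono : {homo k : i j / (i <= j)%N}.

Local Notation path := (nat -> nat).
Local Notation adm := (admissible p q k).

Definition Ex (F : path -> R) : R := (\sum_(w in Om) F (Y w)) / #|Om|%:R.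

Lemma card_Om_gt0 : 0 < #|Om|%:R :> R.
Proof. by case: Y_par => ? *; rewrite ltr0n. Qed.

Lemma eq_Ex (F G : path -> R) : (forall g, adm g -> F g = G g) -> Ex F = Ex G.
Proof.
by move=> FG; congr (_ / _); apply: eq_bigr => w wO; apply: FG; case: Y_par => _ /(_ w wO).
Qed.

Lemma ExD (F G : path -> R) : Ex (fun g => F g + G g) = Ex F + Ex G.
Proof. by rewrite /Ex big_split mulrDl. Qed.

Lemma ExZ (c : R) (F : path -> R) : Ex (fun g => c * F g) = c * Ex F.
Proof. by rewrite /Ex -mulr_sumr mulrA. Qed.

Lemma ExB (F G : path -> R) : Ex (fun g => F g - G g) = Ex F - Ex G.
Proof. by rewrite /Ex sumrB mulrBl. Qed.

Lemma Ex_cst (c : R) : Ex (fun=> c) = c.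
Proof.
rewrite /Ex sumr_const -[c *+ _]mulr_natr mulfK //; exact: lt0r_neq0 card_Om_gt0.
Qed.

Lemma le_Ex (F G : path -> R) : (forall g, adm g -> F g <= G g) -> Ex F <= Ex G.
Proof.
move=> FG; rewrite ler_pM2r ?invr_gt0 ?card_Om_gt0 //.
by apply: ler_sum => w wO; apply: FG; case: Y_par => _ /(_ w wO).
Qed.

Lemma Ex_ge0 (F : path -> R) : (forall g, adm g -> 0 <= F g) -> 0 <= Ex F.
Proof. by move=> F0; rewrite -[leLHS](Ex_cst 0) le_Ex. Qed.

Lemma Ex_sum (I : Type) (r : seq I) (P : pred I) (F : I -> path -> R) :
  Ex (fun g => \sum_(i <- r | P i) F i g) = \sum_(i <- r | P i) Ex (F i).
Proof. by rewrite /Ex exchange_big mulr_suml. Qed.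

Lemma Ex_sqr (F : path -> R) : Ex F ^+ 2 <= Ex (fun g => F g ^+ 2).
Proof.
have : 0 <= Ex (fun g => (F g - Ex F) ^+ 2).
  by apply: Ex_ge0 => g _; apply: sqr_ge0.
rewrite (eq_Ex (G := fun g => F g ^+ 2 + (- (2 * Ex F) * F g + Ex F ^+ 2))).
  by rewrite ExD ExD ExZ Ex_cst; lra.
by move=> g _; ring.
Qed.

(** An injective self-map of the finite set of admissible paths permutes it, so the uniform measure
    is preserved. [T] is the induced map on parameters; surjectivity of [Y] ensures that its default
    value is never taken on [Om]. *)
Lemma Ex_map (G : path -> path) (F : path -> R) :
  (forall g, adm g -> adm (G g)) ->
  (forall g h, adm g -> adm h -> G g = G h -> g = h) ->
  Ex (fun g => F (G g)) = Ex F.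
Proof.
case: Y_par => _ Yadm Yinj Ysurj Gadm Ginj; congr (_ / _).
pose T w := odflt w [pick w' in Om | `[< Y w' = G (Y w) >]].
have TP w : w \in Om -> T w \in Om /\ Y (T w) = G (Y w).
  move=> wO; rewrite /T; case: pickP => [w' /andP[w'O /asboolP]//|none].
  have [w' w'O Ew'] := Ysurj _ (Gadm _ (Yadm _ wO)).
  by have := none w'; rewrite /= w'O /= => /asboolP.
have Tinj : {in Om &, injective T}.
  move=> v w vO wO vw; apply: Yinj => //.
  apply: Ginj; [exact: Yadm|exact: Yadm|].
  by have [_ <-] := TP _ vO; have [_ <-] := TP _ wO; rewrite vw.
have TOm : T @: Om = Om.
  apply/eqP; rewrite eqEcard card_in_imset // leqnn andbT.
  by apply/fintype.subsetP => _ /imsetP[w wO ->]; have [] := TP _ wO.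
rewrite -[in RHS]TOm big_imset //=; apply: eq_bigr => w wO.
by have [_ ->] := TP _ wO.
Qed.

Definition site_invariant (i : nat) (H : path -> R) : Prop :=
  forall g v, H (set_at g i.+1 v) = H g.

Lemma Ex_reflect (i : nat) (F : path -> R) :
  (i < p)%N -> Ex (fun g => F (reflect_at k i g)) = Ex F.
Proof.
move=> ip; apply: Ex_map => [g|g h].
  exact: admissible_reflect.
exact: reflect_inj.
Qed.

Lemma Ex_rotate (i : nat) (F : path -> R) :
  (i < p)%N -> Ex (fun g => F (rotate_at k i g)) = Ex F.
Proof.
move=> ip; apply: Ex_map => [g|g h].
  exact: admissible_rotate.
exact: rotate_inj.
Qed.

(* Reflecting the site value in its range changes the sign of the integrand. *)
Lemma Ex_site_centered (i : nat) (H : path -> R) :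
  (i < p)%N -> site_invariant i H ->
  Ex (fun g => H g * (2 * (g i.+1)%:R - (g i)%:R - (ceiling k g i)%:R)) = 0.
Proof.
move=> ip Hi; set F := fun g : path => _.
suff : Ex F = - Ex F by lra.
rewrite -[LHS](Ex_reflect _ ip) -mulN1r -ExZ; apply: eq_Ex => g ga.
have [g1 g2] := admissible_site i ga.
rewrite /F /reflect_at Hi floor_set_at ceiling_set_at set_at_same.
by rewrite natrB ?natrD; [ring|lia].
Qed.

(** A path and its rotation differ at the site by at least half the width of the range, so they
    cannot both be close to [c]. The factor 16 collects a 4 from this half, a 2 from the square of a
    difference, and a 2 from averaging the two paths. *)
Lemma Ex_site_dispersion (i : nat) (H c : path -> R) :
  (i < p)%N -> site_invariant i H -> site_invariant i c ->
  (forall g, adm g -> 0 <= H g) ->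
  Ex (fun g => H g * ((ceiling k g i)%:R - (g i)%:R) ^+ 2) <=
  16 * Ex (fun g => H g * ((g i.+1)%:R - c g) ^+ 2).
Proof.
move=> ip Hi ci H0; set F := fun g : path => H g * (_ - c g) ^+ 2.
have -> : 16 * Ex F = 8 * (Ex F + Ex (fun g => F (rotate_at k i g))).
  by rewrite Ex_rotate //; ring.
rewrite -ExD -ExZ; apply: le_Ex => g ga.
have [g1 g2] := admissible_site i ga.
rewrite /F /rotate_at Hi ci set_at_same.
have [|r1 r2 r3] := @rotate_bounds (g i) (ceiling k g i) (g i.+1); first lia.
set v := (X in _ + _ * (X%:R - _) ^+ 2); rewrite -/v in r1 r2 r3.
set x := (g i.+1)%:R - c g; set y := v%:R - c g.
rewrite (_ : 8 * _ = H g * (8 * (x ^+ 2 + y ^+ 2))); last by ring.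
apply: ler_wpM2l; first exact: H0.
have : ((ceiling k g i)%:R - (g i)%:R) ^+ 2 <= 4 * (x - y) ^+ 2 :> R.
  have -> : x - y = (g i.+1)%:R - v%:R by rewrite /x /y; ring.
  have gapE : (ceiling k g i)%:R - (g i)%:R = (ceiling k g i - g i)%:R :> R.
    by rewrite natrB //; lia.
  case: r3 => r3.
    have -> : (g i.+1)%:R - v%:R = - ((ceiling k g i - g i).+1./2)%:R :> R.
      by rewrite r3 natrD; ring.
    rewrite gapE sqrrN -natrX -natrX -natrM ler_nat.
    have : (ceiling k g i - g i <= 2 * (ceiling k g i - g i).+1./2)%N by lia.
    by rewrite -leq_sqr expnMn.
  have -> : (g i.+1)%:R - v%:R =
      ((ceiling k g i - g i).+1 - (ceiling k g i - g i).+1./2)%:R :> R.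
    by rewrite -r3 natrD; ring.
  rewrite gapE -natrX -natrX -natrM ler_nat.
  have : (ceiling k g i - g i <= 2 * ((ceiling k g i - g i).+1 -
      (ceiling k g i - g i).+1./2))%N by lia.
  by rewrite -leq_sqr expnMn.
move=> /le_trans; apply; rewrite -subr_ge0.
by rewrite (_ : _ - _ = 4 * (x + y) ^+ 2); [rewrite mulr_ge0 ?sqr_ge0|ring].
Qed.

Definition mean (i : nat) : R := Ex (fun g => (g i)%:R).

Definition slope (i : nat) : R := mean i.+1 - mean i.

Definition var (i : nat) : R := Ex (fun g => ((g i)%:R - mean i) ^+ 2).

(** The expected midpoint of the range is the mean of the site, so the mean width is twice the
    increment on the left of the site. *)
Lemma Ex_gap (i : nat) :
  (i < p)%N -> Ex (fun g => (ceiling k g i)%:R - (g i)%:R) = 2 * slope i.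
Proof.
move=> ip; have := @Ex_site_centered i (fun=> 1) ip (fun _ _ => erefl).
rewrite (eq_Ex (G := fun g => 2 * ((g i.+1)%:R - (g i)%:R) -
   ((ceiling k g i)%:R - (g i)%:R))); last by move=> g _; ring.
by rewrite ExB ExZ ExB -/(mean _) -/(mean _) -/(slope _) => /subr0_eq.
Qed.

(** If [ceiling] were always [g i.+2], the mean would be linear at the site. It falls short exactly
    by the overshoot of [g i.+2] above [k i.+1]. *)
Lemma slopeS (i : nat) : (i < p)%N ->
  slope i.+1 - slope i = Ex (fun g => (g i.+2 - k i.+1)%:R).
Proof.
move=> ip; have := Ex_gap ip; rewrite /slope.
rewrite (eq_Ex (F := fun g => (g i.+2 - k i.+1)%:R)
  (G := fun g => (g i.+2)%:R - (ceiling k g i)%:R)); last first.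
  by move=> g _; rewrite -natrB /ceiling; [congr _%:R; lia|lia].
by rewrite !ExB -/(mean _) -/(mean _); lra.
Qed.

Lemma slope_mono (i j : nat) : (i <= j <= p)%N -> slope i <= slope j.
Proof.
elim: j => [|j IH] /andP[ij jp]; first by have -> : i = 0%N by lia.
have [->//|inj] := eqVneq i j.+1.
apply: (le_trans (IH _)); first lia.
by rewrite -subr_ge0 slopeS // Ex_ge0.
Qed.

(** The range has mean width [2 * slope i], hence mean square width at least [4 * slope i ^+ 2], and
    dispersion about the mean follows. *)
Lemma var_ge_slope (i : nat) : (i < p)%N -> slope i ^+ 2 <= 4 * var i.+1.
Proof.
move=> ip; have := @Ex_site_dispersion i (fun=> 1) (fun=> mean i.+1) ip
  (fun _ _ => erefl) (fun _ _ => erefl) (fun _ _ => ler01).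
have := Ex_sqr (fun g => (ceiling k g i)%:R - (g i)%:R).
rewrite Ex_gap // (eq_Ex (G := fun g => 1 * ((ceiling k g i)%:R - (g i)%:R) ^+ 2));
  last by move=> g _; rewrite mul1r.
move=> h1 /(le_trans h1).
rewrite (eq_Ex (F := fun g => 1 * ((g i.+1)%:R - mean i.+1) ^+ 2)
   (G := fun g => ((g i.+1)%:R - mean i.+1) ^+ 2)); last by move=> g _; rewrite mul1r.
rewrite -/(var _); lra.
Qed.

Lemma mean_mono (i j : nat) : (i <= j)%N -> mean i <= mean j.
Proof. by move=> ij; apply: le_Ex => g [_ gH _ _]; rewrite ler_nat gH. Qed.

Lemma mean_le (i : nat) : mean i <= (k i)%:R.
Proof. by rewrite -[leRHS]Ex_cst; apply: le_Ex => g [_ _ gk _]; rewrite ler_nat. Qed.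

Lemma mean_ge0 (i : nat) : 0 <= mean i.
Proof. by apply: Ex_ge0 => g _. Qed.

Lemma mean0 : mean 0 = 0.
Proof. by rewrite /mean (eq_Ex (G := fun=> 0)) ?Ex_cst // => g [-> _ _ _]. Qed.

Lemma mean_telescope (i j : nat) : (i <= j)%N ->
  mean j - mean i = \sum_(i <= l < j) slope l.
Proof. by move=> ij; rewrite telescope_sumr. Qed.

Lemma mean_sub_le (i j : nat) : (i <= j <= p.+1)%N ->
  mean j - mean i <= (j - i)%:R * slope j.-1.
Proof.
move=> /andP[ij jp]; rewrite mean_telescope // mulr_natl -[leRHS]sumr_const_nat.
rewrite big_nat_cond [leRHS]big_nat_cond; apply: ler_sum => l /andP[/andP[il lj] _].
by apply: slope_mono; lia.
Qed.

Lemma mean_sub_ge (i j : nat) : (i <= j <= p.+1)%N ->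
  (j - i)%:R * slope i <= mean j - mean i.
Proof.
move=> /andP[ij jp]; rewrite mean_telescope // mulr_natl -[leLHS]sumr_const_nat.
rewrite big_nat_cond [leRHS]big_nat_cond; apply: ler_sum => l /andP[/andP[il lj] _].
by apply: slope_mono; lia.
Qed.

(* Below the barrier, the truncation of a path at height [th] is concave on
   average: reflection preserves a path under the level of the truncation, and
   truncating is a concave operation. *)
Lemma mean_min_concave (th i : nat) : (i < p)%N -> (th <= k i.+1)%N ->
  Ex (fun g => (minn (g i) th)%:R) + Ex (fun g => (minn (g i.+2) th)%:R) <=
  2 * Ex (fun g => (minn (g i.+1) th)%:R).
Proof.
move=> ip thk; set F := fun g : path => (minn (g i.+1) th)%:R : R.
have -> : 2 * Ex F = Ex F + Ex (fun g => F (reflect_at k i g)).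
  by rewrite Ex_reflect //; ring.
rewrite -!ExD; apply: le_Ex => g ga; have [g1 g2] := admissible_site i ga.
rewrite /F /reflect_at set_at_same -!natrD ler_nat.
have : minn (ceiling k g i) th = minn (g i.+2) th by rewrite /ceiling; lia.
by move: (ceiling k g i) g1 g2 => b; lia.
Qed.

End Expectation.

(** A discrete Dirichlet problem with a point source: up to the factor [2 * kappa], the solution at
    [j] is the Green function of the segment at [(j, j)]. *)
Lemma discrete_tent (R : realFieldType) (c : nat -> R) (lo j hi : nat) (kappa : R) :
  (lo < j < hi)%N -> c lo = 0 -> c hi = 0 ->
  (forall i, (lo <= i)%N -> (i.+1 < hi)%N ->
     2 * c i.+1 - c i - c i.+2 = if i.+1 == j then 2 * kappa else 0) ->
  c j * (hi - lo)%:R = 2 * kappa * ((j - lo)%:R * (hi - j)%:R).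
Proof.
move=> /andP[loj jhi] clo chi H.
(* A zero at the end and no kink before [j] make [c] proportional to the distance from that end. *)
have left t : (lo + t < j)%N ->
    c (lo + t)%N = t%:R * c lo.+1 /\ c (lo + t).+1 = t.+1%:R * c lo.+1.
  elim: t => [|t IH] tj; first by rewrite addn0 clo mul0r mul1r.
  have [|h1 h2] := IH; first lia.
  have := H (lo + t)%N; rewrite ifF; last by apply/eqP; lia.
  rewrite addnS h1 h2 => /(_ _ _)/[dup] H'; split => //.
  have /H' : (lo <= lo + t)%N by lia.
  have : ((lo + t).+1 < hi)%N by lia.
  move=> h /(_ h); rewrite -[t.+2]addn2 -[t.+1]addn1 !natrD => E; lra.
have right t : (j + t < hi)%N ->
    c (hi - t)%N = t%:R * c hi.-1 /\ c (hi - t).-1 = t.+1%:R * c hi.-1.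
  elim: t => [|t IH] tj; first by rewrite subn0 chi mul0r mul1r.
  have [|h1 h2] := IH; first lia.
  have e1 : (hi - t.+1 = (hi - t).-1)%N by lia.
  rewrite e1 h2; split => //.
  have := H (hi - t).-1.-1; rewrite ifF; last by apply/eqP; lia.
  have -> : (hi - t).-1.-1.+2 = (hi - t)%N by lia.
  have -> : (hi - t).-1.-1.+1 = (hi - t).-1 by lia.
  rewrite h1 h2 => /(_ _ _)H'.
  have : 2 * (t.+1%:R * c hi.-1) - c (hi - t).-1.-1 - t%:R * c hi.-1 = 0.
    by apply: H'; lia.
  by rewrite -[t.+2]addn2 -[t.+1]addn1 !natrD => E; lra.
have [|l1 l2] := left (j - lo).-1; first lia.
have [|r1 r2] := right (hi - j).-1; first lia.
have e1 : (lo + (j - lo).-1 = j.-1)%N by lia.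
have e2 : (hi - (hi - j).-1 = j.+1)%N by lia.
have := H j.-1; rewrite prednK; last lia.
rewrite eqxx => /(_ _ _)H'.
have {H'} : 2 * c j - c j.-1 - c j.+1 = 2 * kappa by apply: H'; lia.
move: l1 l2 r1 r2; rewrite e1 e2 /= prednK; last lia.
rewrite prednK; last lia.
rewrite prednK; last lia.
have -> : (hi - lo)%:R = (j - lo)%:R + (hi - j)%:R :> R by rewrite -natrD; congr _%:R; lia.
have natr_pred n : (0 < n)%N -> n.-1%:R = n%:R - 1 :> R.
  by case: n => // n _; rewrite -natr1 addrK.
rewrite !natr_pred; [|lia|lia].
move: (j - lo)%:R (hi - j)%:R => a b -> l2 -> r2 E.
have -> : kappa = (c lo.+1 + c hi.-1) / 2 by lra.
by rewrite mulrDr {1}r2 l2; field.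
Qed.

(** * Covariances in a window free of the barrier *)

Section Window.
Variables (R : realType) (W : finType) (Om : {set W}) (Y : W -> nat -> nat).
Variables (p q : nat) (k : nat -> nat).
Hypothesis Y_par : parametrizes Om Y p q k.
Hypothesis k_mono : {homo k : i j / (i <= j)%N}.

Local Notation path := (nat -> nat).
Local Notation adm := (admissible p q k).
Local Notation Ex := (@Ex R W Om Y).

Variables (lo j hi : nat).
Hypotheses (loj : (lo < j)%N) (jhi : (j < hi)%N) (hip : (hi <= p)%N).

(* [1] if the barrier cannot meet the path between [lo] and [hi], else [0]. *)
Definition free_window (g : path) : R := (g hi <= k lo)%N%:R.

Let chi := free_window.
Let len : R := (hi - lo)%:R.
Let rise (g : path) : R := (g hi)%:R - (g lo)%:R.
Let chord (l : nat) (g : path) : R := (g lo)%:R + rise g * (l - lo)%:R / len.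

Let len_gt0 : 0 < len.
Proof. by rewrite ltr0n; lia. Qed.

Let out_invariant (i : nat) : (lo <= i)%N -> (i.+1 < hi)%N ->
  forall g v, set_at g i.+1 v lo = g lo /\ set_at g i.+1 v hi = g hi.
Proof. by move=> loi ihi g v; rewrite !set_at_other //; apply/eqP; lia. Qed.

Let chi_invariant (i : nat) : (lo <= i)%N -> (i.+1 < hi)%N -> site_invariant i chi.
Proof.
by move=> loi ihi g v; rewrite /chi /free_window; have [_ ->] := out_invariant loi ihi g v.
Qed.

Let chord_invariant (l i : nat) : (lo <= i)%N -> (i.+1 < hi)%N -> site_invariant i (chord l).
Proof.
by move=> loi ihi g v; rewrite /chord /rise; have [-> ->] := out_invariant loi ihi g v.
Qed.

(** In a free window the barrier is above [g hi] at every site, so the range of a site is bounded by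
    its neighbours alone. *)
Let chi_ceiling (i : nat) (g : path) (x : R) : (lo <= i)%N -> (i.+1 < hi)%N -> adm g ->
  chi g * (x - (ceiling k g i)%:R) = chi g * (x - (g i.+2)%:R).
Proof.
move=> loi ihi [_ gH _ _]; rewrite /chi /free_window; case: leqP => gk; last by rewrite !mul0r.
congr (_ * (_ - _%:R)); rewrite /ceiling; apply/minn_idPl.
by apply: leq_trans (gH _ hi _) (leq_trans gk (k_mono _)); lia.
Qed.

Let chord_lo g : chord lo g = (g lo)%:R.
Proof. by rewrite /chord subnn mulr0 mul0r addr0. Qed.

Let chord_hi g : chord hi g = (g hi)%:R.
Proof. by rewrite /chord mulfK ?gt_eqF // /rise addrC subrK. Qed.

Let chord_linear (i : nat) g : (lo <= i)%N ->
  2 * chord i.+1 g - chord i g - chord i.+2 g = 0.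
Proof.
move=> loi; rewrite /chord !subSn ?(leq_trans loi) //.
by rewrite -[in X in _ - X]addn2 -[in X in X - _ - _]addn1 !natrD; lra.
Qed.

Let second_diff (i : nat) (psi : path -> R) : (lo <= i)%N -> (i.+1 < hi)%N ->
  let c l := Ex (fun g => chi g * psi g * ((g l)%:R - chord l g)) in
  2 * c i.+1 - c i - c i.+2 =
  Ex (fun g => chi g * psi g *
               (2 * (g i.+1)%:R - (g i)%:R - (ceiling k g i)%:R)).
Proof.
move=> loi ihi /=; rewrite -ExZ -!ExB; apply: (eq_Ex Y_par) => g ga.
rewrite ![chi g * psi g]mulrC -!mulrA chi_ceiling //.
have := chord_linear g loi => E.
rewrite -[RHS]subr0 -(mulr0 (psi g * chi g)) -E; ring.
Qed.

(** Weighted by a quantity that the interior sites do not influence, the mean deviation from the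
    chord has no kink and vanishes at both ends, hence everywhere. The chord thus acts as a
    conditional expectation. *)
Let Ex_chord (psi : path -> R) (l : nat) : (lo < l < hi)%N ->
  (forall i, (lo <= i)%N -> (i.+1 < hi)%N -> site_invariant i psi) ->
  Ex (fun g => chi g * psi g * ((g l)%:R - chord l g)) = 0.
Proof.
move=> lol psi_i; pose c l := Ex (fun g => chi g * psi g * ((g l)%:R - chord l g)).
have : c l * (hi - lo)%:R = 2 * 0 * ((l - lo)%:R * (hi - l)%:R).
  apply: discrete_tent => // [||i loi ihi].
  - rewrite /c (eq_Ex Y_par (G := fun=> 0)) ?(Ex_cst Y_par) // => g _.
    by rewrite chord_lo subrr mulr0.
  - rewrite /c (eq_Ex Y_par (G := fun=> 0)) ?(Ex_cst Y_par) // => g _.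
    by rewrite chord_hi subrr mulr0.
  rewrite second_diff // mulr0 if_same.
  apply: (@Ex_site_centered R W Om Y p q k Y_par i (fun g => chi g * psi g)); first lia.
  by move=> g v; rewrite chi_invariant // psi_i.
rewrite mulr0 mul0r => /eqP; rewrite mulf_eq0 => /orP[/eqP //|].
by rewrite gt_eqF //; exact: len_gt0.
Qed.

(* The covariance with the value at [j] is harmonic off [j] and vanishes at
   the ends of the window, hence it is a tent. *)
Lemma window_variance (c : R) :
  Ex (fun g => free_window g * ((g hi)%:R - (g lo)%:R)) *
    ((j - lo)%:R * (hi - j)%:R) <=
  4 * (hi - lo)%:R ^+ 2 * Ex (fun g => ((g j)%:R - c) ^+ 2).
Proof.
pose i := j.-1; have ij : i.+1 = j by rewrite /i; lia.
have loi : (lo <= i)%N by lia.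
have ihi : (i.+1 < hi)%N by lia.
have ip : (i < p)%N by lia.
pose mid (g : path) : R := ((g i)%:R + (ceiling k g i)%:R) / 2.
have mid_i : site_invariant i mid.
  by move=> g v; rewrite /mid ceiling_set_at floor_set_at.
(* The local fluctuation of site [j] about the midpoint of its range; it is the source of the
   tent. *)
pose kappa := Ex (fun g => chi g * ((g j)%:R - mid g) ^+ 2).
pose V := Ex (fun g => chi g * ((g j)%:R - chord j g) ^+ 2).
have Vkappa : V * len = 2 * kappa * ((j - lo)%:R * (hi - j)%:R).
  pose cov l := Ex (fun g => chi g * ((g j)%:R - chord j g) * ((g l)%:R - chord l g)).
  have -> : V = cov j by apply: (eq_Ex Y_par) => g _; ring.
  apply: discrete_tent => [|||a loa ahi].
  - by rewrite loj jhi.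
  - rewrite /cov (eq_Ex Y_par (G := fun=> 0)) ?(Ex_cst Y_par) // => g _.
    by rewrite chord_lo subrr mulr0.
  - rewrite /cov (eq_Ex Y_par (G := fun=> 0)) ?(Ex_cst Y_par) // => g _.
    by rewrite chord_hi subrr mulr0.
  rewrite second_diff //; case: eqP => [aj|/eqP aj].
    have -> : a = i by lia.
    (* Split the deviation from the chord at [mid]. The part [mid g - chord j g] does not depend on
       site [j], so it contributes nothing against the centered factor. *)
    rewrite /kappa -ExZ.
    rewrite (eq_Ex Y_par (G := fun g => 2 * (chi g * ((g j)%:R - mid g) ^+ 2) +
      (chi g * (mid g - chord j g)) * (2 * (g i.+1)%:R - (g i)%:R - (ceiling k g i)%:R))).
      rewrite ExD (Ex_site_centered Y_par ip) ?addr0 // => g v.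
      by rewrite chi_invariant // mid_i chord_invariant.
    by move=> g _; rewrite ij /mid; field.
  apply: (@Ex_site_centered R W Om Y p q k Y_par a (fun g => chi g * ((g j)%:R - chord j g))); first lia.
  move=> g v; rewrite chi_invariant // chord_invariant // set_at_other //.
  by rewrite eq_sym.
(* An integer width is at most its square, so the mean width of the range bounds the dispersion from
   below. In a free window the range spans two steps of the chord, so this mean width is [2 / len]
   times the mean rise. *)
have kappa_ge : Ex (fun g => chi g * rise g) <= 8 * len * kappa.
  have chi0 g : 0 <= chi g by rewrite ler0n.
  have := @Ex_site_dispersion R W Om Y p q k Y_par i chi mid ip
    (chi_invariant loi ihi) mid_i (fun g _ => chi0 g).
  rewrite ij -/kappa => h.
  have {}h : Ex (fun g => chi g * ((ceiling k g i)%:R - (g i)%:R)) <= 16 * kappa.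
    apply: le_trans h; apply: (le_Ex Y_par) => g ga; apply: ler_wpM2l => //.
    have [g1 g2] := admissible_site i ga; rewrite -natrB; last lia.
    by rewrite -natrX ler_nat; case: (_ - _)%N => // n; rewrite expnS expn1 leq_pmulr.
  have hE : Ex (fun g => chi g * ((ceiling k g i)%:R - (g i)%:R)) * len =
      2 * Ex (fun g => chi g * rise g).
    suff -> : Ex (fun g => chi g * ((ceiling k g i)%:R - (g i)%:R)) =
      Ex (fun g => chi g * (chord i.+2 g - chord i g)).
      rewrite mulrC -!ExZ; apply: (eq_Ex Y_par) => g _.
      rewrite /chord !subSn ?(leq_trans loi) // -[(i - lo).+2]addn2 natrD.
      by field; rewrite gt_eqF.
    have chordE l : (lo <= l <= hi)%N -> Ex (fun g => chi g * (g l)%:R) = Ex (fun g => chi g * chord l g).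
      move=> /andP[lol lhi]; apply/eqP; rewrite -subr_eq0 -ExB; apply/eqP.
      have [->|nlo] := eqVneq l lo.
        rewrite (eq_Ex Y_par (G := fun=> 0)) ?(Ex_cst Y_par) // => g _.
        by rewrite chord_lo subrr.
      have [->|nhi] := eqVneq l hi.
        rewrite (eq_Ex Y_par (G := fun=> 0)) ?(Ex_cst Y_par) // => g _.
        by rewrite chord_hi subrr.
      rewrite -[RHS](@Ex_chord (fun=> 1) l) //; last lia.
      by apply: (eq_Ex Y_par) => g _; ring.
    rewrite (eq_Ex Y_par (G := fun g => chi g * (g i.+2)%:R - chi g * (g i)%:R)); last first.
      move=> g ga; have := chi_ceiling (g i)%:R loi ihi ga; rewrite !mulrBr; lra.
    rewrite ExB !chordE; [|lia|lia].
    by rewrite -ExB; apply: (eq_Ex Y_par) => g _; ring.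
  have := ler_wpM2r (ltW len_gt0) h; rewrite hE; lra.
(* The deviation from the chord is orthogonal to [chord j g - c], so replacing the chord by a
   constant only adds a square. *)
have V_le : V <= Ex (fun g => ((g j)%:R - c) ^+ 2).
  apply: (@le_trans _ _ (Ex (fun g => chi g * ((g j)%:R - c) ^+ 2))); last first.
    apply: (le_Ex Y_par) => g _; rewrite /chi /free_window.
    by case: leqP; rewrite ?mul1r ?mul0r ?sqr_ge0.
  rewrite (eq_Ex Y_par (G := fun g => chi g * ((g j)%:R - chord j g) ^+ 2 +
     (2 * (chi g * (chord j g - c) * ((g j)%:R - chord j g)) +
      chi g * (chord j g - c) ^+ 2))); last by move=> g _; ring.
  rewrite ExD ExD ExZ Ex_chord ?loj //; last first.
    by move=> a loa ahi g v; rewrite chord_invariant.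
  rewrite mulr0 add0r lerDl; apply: (Ex_ge0 Y_par) => g _.
  by rewrite mulr_ge0 ?ler0n ?sqr_ge0.
rewrite -/chi -/len -/(rise _).
have ab0 : 0 <= (j - lo)%:R * (hi - j)%:R :> R by rewrite mulr_ge0.
apply: (le_trans (ler_wpM2r ab0 kappa_ge)).
rewrite (_ : 8 * len * kappa * _ = 4 * len * (2 * kappa * ((j - lo)%:R * (hi - j)%:R))); last by ring.
rewrite -Vkappa (_ : 4 * len * _ = 4 * len ^+ 2 * V); last by ring.
by rewrite ler_wpM2l // mulr_ge0 ?sqr_ge0.
Qed.

End Window.

(** * The probability that a window is not free *)

Section Crossing.
Variables (R : realType) (W : finType) (Om : {set W}) (Y : W -> nat -> nat).
Variables (p q : nat) (k : nat -> nat).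
Hypothesis Y_par : parametrizes Om Y p q k.
Hypothesis k_mono : {homo k : i j / (i <= j)%N}.

Local Notation path := (nat -> nat).
Local Notation adm := (admissible p q k).
Local Notation Ex := (@Ex R W Om Y).
Local Notation slope := (@slope R W Om Y).

Variables (lo hi H : nat).
Hypotheses (lo_gt0 : (0 < lo)%N) (lohi : (lo < hi)%N) (hip : (hi <= p)%N).

(** The path jumps to its final value [g hi] as soon as the barrier permits. If the barrier starts
    below [g hi], the jump passes over the barrier value of the preceding site, which creates an
    overshoot. *)
Definition flatten (g : path) : path :=
  fun i => if (lo < i <= hi)%N && (g hi <= k i)%N then g hi else g i.

Lemma admissible_flatten (g : path) : adm g -> adm (flatten g).
Proof.
move=> [g0 gH gk gp]; split=> [|a b ab|i|i pi]; rewrite /flatten.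
- exact: g0.
- case: ifPn => [/andP[/andP[loa ahi] ka]|na]; case: ifPn => [/andP[/andP[lob bhi] kb]|nb] //.
  + move: nb; rewrite negb_and (leq_trans ka (k_mono ab)) orbF => nb.
    by apply: gH; lia.
  + by apply: gH; lia.
  + exact: gH.
- by case: ifP => [/andP[]|].
- by case: ifP => [/andP[]|_]; [lia|exact: gp].
Qed.

Lemma flatten_crosses (g : path) : adm g -> (k lo < g hi)%N ->
  (0 < \sum_(lo <= l < hi) (flatten g l.+1 - k l))%N.
Proof.
move=> [_ _ gk _] klo.
(* The site where the barrier passes the level [g hi]; the flattened path overshoots there. *)
have [l [lol lhi kl kl1]] : exists l, [/\ (lo <= l)%N, (l < hi)%N, (k l < g hi)%N & (g hi <= k l.+1)%N].
  have : (g hi <= k (lo + (hi - lo)))%N by rewrite subnKC // ltnW.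
  move: (leqnn (hi - lo)); move: {1 3}(hi - lo)%N.
  elim=> [|t IH] tlo; first by rewrite addn0; lia.
  have [h|h] := leqP (g hi) (k (lo + t)); first by move=> _; apply: IH => //; lia.
  by rewrite addnS => kt; exists (lo + t)%N; split => //; lia.
rewrite (big_rem l) /=; last by rewrite mem_index_iota lol.
by rewrite /flatten kl1 andbT ifT; lia.
Qed.

Let bad := [set w in Om | (k lo < Y w hi)%N && (Y w hi - Y w lo <= H)%N].

(** A path is recovered from its flattened image and its values in the window relative to [Y w lo].
    For paths in [bad] each such value is at most [H], so an image has at most [H.+1 ^ (hi - lo)]
    preimages, and it carries an overshoot of at least 1. *)
Lemma card_crossing : (#|bad| <= H.+1 ^ (hi - lo) *
  \sum_(w in Om) \sum_(lo <= l < hi) (Y w l.+1 - k l))%N.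
Proof.
have [_ Yadm Yinj Ysurj] := Y_par.
pose T w := odflt w [pick w' in Om | `[< Y w' = flatten (Y w) >]].
have TP w : w \in Om -> T w \in Om /\ Y (T w) = flatten (Y w).
  move=> wO; rewrite /T; case: pickP => [w' /andP[w'O /asboolP]//|none].
  have [w' w'O Ew'] := Ysurj _ (admissible_flatten (Yadm _ wO)).
  by have := none w'; rewrite /= w'O /= => /asboolP.
have badO w : w \in bad -> w \in Om by rewrite inE => /andP[].
rewrite -sum1_card (partition_big T (mem Om)) => [|w /badO /TP[]//].
rewrite big_distrr /=; apply: leq_sum => v vO.
rewrite sum1dep_card.
have [->|] := eqVneq [set w : W | (w \in bad) && (T w == v)] finset.set0; first by rewrite cards0.
case/finset.set0Pn => u; rewrite inE => /andP[ub /eqP uv].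
have pos : (0 < \sum_(lo <= l < hi) (Y v l.+1 - k l))%N.
  have [_ ] := TP _ (badO _ ub); rewrite uv => ->.
  apply: flatten_crosses; first exact/Yadm/badO.
  by move: ub; rewrite inE => /and3P[].
apply: leq_trans (leq_pmulr _ pos).
pose code w : {ffun 'I_(hi - lo) -> 'I_H.+1} := 
    [ffun t : 'I_(hi - lo) => inord (Y w (lo + t.+1) - Y w lo)].
rewrite -(@card_in_imset _ _ code) => [|w1 w2].
  by apply: (leq_trans (max_card _)); rewrite card_ffun !card_ord.
rewrite !inE => /andP[/and3P[w1O w1k w1H] /eqP T1] /andP[/and3P[w2O w2k w2H] /eqP T2] E.
have F : flatten (Y w1) = flatten (Y w2).
  by have [_ <-] := TP _ w1O; have [_ <-] := TP _ w2O; rewrite T1 T2.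
have [_ H1 _ _] := Yadm _ w1O; have [_ H2 _ _] := Yadm _ w2O.
have out i : ~~ (lo < i <= hi)%N -> Y w1 i = Y w2 i.
  by move=> /negPf ni; have := congr1 (fun u => u i) F; rewrite /flatten ni.
have Elo : Y w1 lo = Y w2 lo by apply: out; lia.
apply: Yinj => //; apply/funext => i.
case: (boolP (lo < i <= hi)%N) => [/andP[loi ihi]|/out//].
have ti : (i - lo.+1 < hi - lo)%N by lia.
have := congr1 (fun u : {ffun 'I_(hi - lo) -> 'I_H.+1} => val (u (Ordinal ti))) E.
rewrite !ffunE /=.
have -> : (lo + (i - lo.+1).+1 = i)%N by lia.
have := H1 _ _ ihi; have := H2 _ _ ihi.
have := H1 _ _ (ltnW loi); have := H2 _ _ (ltnW loi).
by move=> ? ? ? ?; rewrite !inordK; lia.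
Qed.

Lemma crossing_probability :
  Ex (fun g => ((k lo < g hi)%N && (g hi - g lo <= H)%N)%:R) <=
  (H.+1 ^ (hi - lo))%:R * (slope hi.-1 - slope lo.-1).
Proof.
(* The expected overshoots are second differences, so their sum telescopes to an increment of the
   slope. *)
have -> : slope hi.-1 - slope lo.-1 = Ex (fun g => \sum_(lo <= l < hi) (g l.+1 - k l)%:R).
  have -> : lo = lo.-1.+1 by lia.
  have -> : hi = hi.-1.+1 by lia.
  rewrite Ex_sum /= -telescope_sumr; last lia.
  rewrite big_add1 /= big_nat_cond [RHS]big_nat_cond; apply: eq_bigr => l /andP[/andP[_ lh] _].
  by rewrite -(slopeS R Y_par) //; lia.
rewrite -ExZ ler_pM2r ?invr_gt0 ?(card_Om_gt0 _ Y_par) //.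
have := card_crossing; rewrite -(ler_nat R) natrM natr_sum.
rewrite mulr_sumr => h.
have -> : \sum_(w in Om) ((k lo < Y w hi)%N && (Y w hi - Y w lo <= H)%N)%:R = #|bad|%:R :> R.
  rewrite -sum1_card natr_sum big_mkcond [RHS]big_mkcond /=; apply: eq_bigr => w _.
  by rewrite inE; case: (w \in Om) => //=; case: ifP.
apply: (le_trans h); rewrite le_eqVlt; apply/orP; left; apply/eqP.
by apply: eq_bigr => w _; rewrite natr_sum.
Qed.

End Crossing.

(** * Slopes and fluctuations *)

Lemma concave_increment (R : realFieldType) (u : nat -> R) (M : nat) :
  (forall s, (s < M)%N -> u s + u s.+2 <= 2 * u s.+1) ->
  M%:R * (u M.+1 - u M) <= u M - u 0%N.
Proof.
elim: M => [|M IH] H; first by rewrite mul0r subrr.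
have := IH (fun s sM => H s (ltnW sM)); have := H M (ltnSn M).
rewrite -natr1 => h1 h2.
have M0 : 0 <= M%:R :> R by [].
by nra.
Qed.

Lemma concave_above_chord (R : realFieldType) (u : nat -> R) (M t : nat) :
  (forall s, (s.+1 < M)%N -> u s + u s.+2 <= 2 * u s.+1) -> (t <= M)%N ->
  t%:R * (u M - u 0%N) <= M%:R * (u t - u 0%N).
Proof.
elim: M => [|M IH] H tM; first by have -> : t = 0%N by lia.
have [->//|tM1] := eqVneq t M.+1.
have {IH}h1 := IH (fun s sM => H s (ltnW sM)) ltac:(lia).
have h2 := @concave_increment _ u M (fun s sM => H s sM).
have [M0|M0] := posnP M.
  by have -> : t = 0%N by [lia]; rewrite subrr mul0r mulr0.
have M0' : 0 < M%:R :> R by rewrite ltr0n.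
have t0 : 0 <= t%:R :> R by [].
rewrite -(ler_pM2l M0') -natr1.
have := ler_wpM2l t0 h2.
have := ler_wpM2l (addr_ge0 (ltW M0') ler01) h1.
lra.
Qed.

Lemma slow_step (R : realFieldType) (phi : nat -> R) (V : nat) (C : R) :
  (0 < V)%N -> phi V - phi 0%N <= C ->
  exists2 v, (v < V)%N & V%:R * (phi v.+1 - phi v) <= C.
Proof.
move=> V0 phiC; apply: contrapT => none.
have : V%:R * (phi V - phi 0%N) > V%:R * C.
  rewrite -telescope_sumr // mulr_sumr mulr_natl -{1}[V]subn0 -sumr_const_nat.
  apply: ltr_sum_nat => // v /andP[_ vV]; rewrite ltNge; apply/negP => h.
  by apply: none; exists v.
by rewrite ltr_pM2l ?ltr0n // ltNge phiC.
Qed.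

Section Spread.
Variables (R : realType) (W : finType) (Om : {set W}) (Y : W -> nat -> nat).
Variables (p q : nat) (k : nat -> nat).
Hypothesis Y_par : parametrizes Om Y p q k.
Hypothesis k_mono : {homo k : i j / (i <= j)%N}.
Hypothesis k_le : forall i, (k i <= q)%N.

Local Notation path := (nat -> nat).
Local Notation adm := (admissible p q k).
Local Notation Ex := (@Ex R W Om Y).
Local Notation mean := (@mean R W Om Y).
Local Notation slope := (@slope R W Om Y).
Local Notation var := (@var R W Om Y).

Lemma slope_ge0 (i : nat) : 0 <= slope i.
Proof. by rewrite subr_ge0 (mean_mono _ Y_par). Qed.

(** Outside the free event, rises at most [H] are rare by [crossing_probability], and larger rises
    contribute at most the second moment divided by [H]. The two hypotheses let each loss take at
    most a quarter of [T]. *)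
Lemma free_window_rise (lo hi H : nat) (V : R) :
  (0 < lo)%N -> (lo < hi)%N -> (hi <= p)%N ->
  var lo <= V -> var hi <= V ->
  let T := mean hi - mean lo in
  4 * (4 * V + T ^+ 2) <= H%:R * T ->
  4 * (H%:R * (H.+1 ^ (hi - lo))%:R * (slope hi.-1 - slope lo.-1)) <= T ->
  T <= 2 * Ex (fun g => free_window R k lo hi g * ((g hi)%:R - (g lo)%:R)).
Proof.
move=> lo0 lohi hip vlo vhi T HT XT.
have T0 : 0 <= T by rewrite subr_ge0 (mean_mono _ Y_par) // ltnW.
have V0 : 0 <= V.
  by apply: le_trans vlo; apply: (Ex_ge0 Y_par) => g _; apply: sqr_ge0.
have [T00|T00] := eqVneq T 0.
  rewrite T00 mulr_ge0 //; apply: (Ex_ge0 Y_par) => g [_ gH _ _].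
  by rewrite mulr_ge0 ?ler0n // subr_ge0 ler_nat gH // ltnW.
have {T0 T00}T0 : 0 < T by rewrite lt_neqAle eq_sym T00.
have H0 : 0 < H%:R :> R.
  rewrite ltr0n lt0n; apply/eqP => H00; move: HT; rewrite H00 mul0r.
  by have : 0 < T ^+ 2 by [rewrite exprn_gt0]; lra.
set E := Ex _.
have sq : Ex (fun g => ((g hi)%:R - (g lo)%:R) ^+ 2) <= 4 * V + T ^+ 2.
  have h0 : Ex (fun g => ((g hi)%:R - (g lo)%:R) - T) = 0.
    by rewrite ExB ExB (Ex_cst Y_par) -/(mean _) -/(mean _) -/T subrr.
  have : Ex (fun g => ((g hi)%:R - (g lo)%:R) ^+ 2) <=
      Ex (fun g => 2 * ((g hi)%:R - mean hi) ^+ 2 + 2 * ((g lo)%:R - mean lo) ^+ 2 +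
        (2 * T * ((g hi)%:R - (g lo)%:R - T) + T ^+ 2)).
    apply: (le_Ex Y_par) => g _; rewrite -subr_ge0.
    rewrite (_ : _ - _ = (((g hi)%:R - mean hi) + ((g lo)%:R - mean lo)) ^+ 2) ?sqr_ge0 //.
    by rewrite /T; ring.
  rewrite !ExD !ExZ h0 (Ex_cst Y_par) -/(var _) -/(var _); lra.
have := @crossing_probability R W Om Y p q k Y_par k_mono lo hi H lo0 lohi hip.
set P := Ex _ => cross.
have key : H%:R * T <= H%:R * E + (4 * V + T ^+ 2) + H%:R ^+ 2 * P.
  apply: (@le_trans _ _ (H%:R * E + Ex (fun g => ((g hi)%:R - (g lo)%:R) ^+ 2) + H%:R ^+ 2 * P));
    last by lra.
  have -> : T = Ex (fun g => (g hi)%:R - (g lo)%:R) by rewrite ExB.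
  rewrite -!ExZ -!ExD; apply: (le_Ex Y_par) => g [_ gH _ _].
  have t0 : 0 <= (g hi)%:R - (g lo)%:R :> R by rewrite subr_ge0 ler_nat gH // ltnW.
  have lg : (g lo <= g hi)%N by apply: gH; nat_lia.
  rewrite /free_window; case: leqP => gk /=.
    rewrite mul1r mulr0 addr0 lerDl; exact: sqr_ge0.
  case: leqP => gap /=; rewrite mul0r mulr0 add0r.
    rewrite mulr1 [in leRHS]expr2.
    have := sqr_ge0 ((g hi)%:R - (g lo)%:R : R).
    have : (g hi)%:R - (g lo)%:R <= H%:R :> R by rewrite -natrB // ler_nat.
    by move=> a b; have := ler_wpM2l (ltW H0) a; lra.
  rewrite mulr0 addr0 expr2; apply: ler_wpM2r => //.
  by rewrite -natrB // ler_nat ltnW.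
have h3 : 4 * (H%:R ^+ 2 * P) <= H%:R * T.
  apply: le_trans (ler_wpM2l (ltW H0) XT).
  rewrite expr2 -mulrA mulrCA ler_pM2l // ler_pM2l // -mulrA.
  by rewrite ler_wpM2l // ltW.
rewrite -(ler_pM2l H0); lra.
Qed.

Variables (mu : R) (m n : nat).
Hypotheses (mu_gt0 : 0 < mu) (m_gt0 : (0 < m)%N) (n_gt0 : (0 < n)%N).
Hypothesis area : forall i, (0 < i)%N -> (i <= p)%N ->
  mu * ((p.+1 - i)%:R * (k i)%:R) <= m%:R * n%:R.

Let m0 : 0 < m%:R :> R. Proof. by rewrite ltr0n. Qed.
Let n0 : 0 < n%:R :> R. Proof. by rewrite ltr0n. Qed.

(** Once the barrier has reached a fixed fraction of [n], the area bound leaves room for only order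
    [m] further sites. *)
Lemma few_beyond (i a : nat) : (0 < i)%N -> (i <= p)%N -> (n <= a * k i)%N ->
  mu * (p.+1 - i)%:R <= a%:R * m%:R.
Proof.
move=> i1 ip high; rewrite -(ler_pM2r n0).
have := area i1 ip; rewrite -(ler_nat R) natrM in high => h.
have x0 : 0 <= mu * (p.+1 - i)%:R by rewrite mulr_ge0 // ltW.
have := ler_wpM2l x0 high; have := ler_wpM2l (ler0n R a) h; lra.
Qed.

(** By convexity the slope is at most the average slope over the next [m %/ 64] sites, whose total
    rise is below the barrier at their end. At least [m / 64] sites remain beyond, so the area bound
    applies there. The constant is 64 times 128. *)
Lemma slope_upper (i : nat) : (0 < i <= p)%N -> (m <= 32 * (p - i))%N -> (128 <= m)%N ->
  slope i.-1 <= 8192 / mu * (n%:R / m%:R).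
Proof.
move=> /andP[i1 ip] im m128.
pose w := (m %/ 64)%N.
have w64 : (64 * w <= m)%N by rewrite /w; nat_lia.
have w128 : (m <= 128 * w)%N by rewrite /w; nat_lia.
have iwp : (i + w <= p)%N by nat_lia.
have h1 : w%:R * slope i.-1 <= (k (i + w))%:R.
  apply: (@le_trans _ _ (w%:R * slope i)).
    by apply: ler_wpM2l => //; apply: (slope_mono R Y_par); nat_lia.
  have := mean_sub_ge R Y_par (i := i) (j := i + w) ltac:(nat_lia).
  have -> : (i + w - i = w)%N by nat_lia.
  move=> /le_trans; apply; have := mean_ge0 R Y_par i; have := mean_le R Y_par (i + w)%N; lra.
have h2 := area (i := i + w) ltac:(nat_lia) iwp.
have h3 : m%:R <= 64 * (p.+1 - (i + w))%:R :> R by rewrite -natrM ler_nat; nat_lia.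
have h4 : m%:R <= 128 * w%:R :> R by rewrite -natrM ler_nat.
have s0 := slope_ge0 i.-1.
have k0 : 0 <= (k (i + w))%:R :> R by [].
have step : mu * (k (i + w))%:R <= 64 * n%:R.
  rewrite -(ler_pM2l m0).
  have muk : 0 <= mu * (k (i + w))%:R by rewrite mulr_ge0 // ltW.
  have := ler_wpM2r muk h3; lra.
have step2 : mu * (m%:R * slope i.-1) <= 8192 * n%:R.
  have := ler_wpM2l (ltW mu_gt0) h1.
  have := ler_wpM2l (ltW mu_gt0) (ler_wpM2r s0 h4); lra.
have mm : 0 < mu * m%:R by rewrite mulr_gt0.
rewrite -(ler_pM2l mm) -[leLHS]mulrA; apply: (le_trans step2).
rewrite le_eqVlt; apply/orP; left; apply/eqP.
by field; rewrite !gt_eqF.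
Qed.

Variable i0 : nat.
Hypotheses (i0_gt0 : (0 < i0)%N) (i0_le : (i0 <= p)%N) (i0_high : (n <= 8 * k i0)%N).

(** By convexity the slope dominates the average slope between [z] and [i]. The rise there is at
    least that of the truncated path, which concavity bounds below by [t / M] of its remaining
    climb; [t] is at least [m / 32], while [M] and [i - z] are at most [16 * m / mu]. *)
Lemma slope_lower (i : nat) : (i0 <= i <= p)%N -> (m <= 32 * (i - i0).+1)%N ->
  mu ^+ 2 / 2 ^+ 17 * (n%:R / m%:R) <= slope i.-1.
Proof.
move=> /andP[i0i ip] it.
(* [z] balances two needs: the mean at [z] is still low, and the barrier just after [z] is high
   enough for [few_beyond] to bound [i - z]. *)
have [z [zi0 zlow zhigh]] : exists z, [/\ (z < i0)%N, mean z <= n%:R / 16 &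
    (n <= 16 * k z.+1)%N].
  pose P z := (z < i0)%N && ((z == 0%N) || (16 * k z < n)%N).
  have exP : exists z, P z by exists 0%N; rewrite /P i0_gt0.
  have ubP z : P z -> (z <= i0)%N by case/andP=> /ltnW.
  case: (ex_maxnP exP ubP) => z /andP[zi0 zP] zmax; exists z; split=> //.
    case/orP: zP => [/eqP ->|zP]; first by rewrite (mean0 _ Y_par) divr_ge0 // ltW.
    apply: (le_trans (mean_le _ Y_par z)).
    by move: zP; rewrite -(ltr_nat R) natrM; lra.
  have [->|zi0'] := eqVneq z.+1 i0; first nat_lia.
  have := zmax z.+1; rewrite /P /= ltnNge => h.
  by rewrite leqNgt; apply/negP => h'; move: h; rewrite h' andbT; nat_lia.
(* Truncation at the barrier value of [i0] is concave in mean at all sites from [i0] on, and the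
   convention at [p.+1] forces the truncated path to end at [th]. *)
pose th := k i0; pose zeta l := Ex (fun g => (minn (g l) th)%:R).
have zeta_diff : zeta i - zeta z <= mean i - mean z.
  rewrite -!ExB; apply: (le_Ex Y_par) => g [_ gH _ _].
  have : (g z <= g i)%N by apply: gH; nat_lia.
  move=> h; rewrite -!natrB ?ler_nat; nat_lia.
have zeta_z : zeta z <= zeta i0.-1.
  apply: (le_Ex Y_par) => g [_ gH _ _]; rewrite ler_nat.
  have : (g z <= g i0.-1)%N by apply: gH; nat_lia.
  nat_lia.
have zeta_low : zeta z <= n%:R / 16.
  by apply: le_trans zlow; apply: (le_Ex Y_par) => g _; rewrite ler_nat geq_minl.
have zeta_top : zeta p.+1 = th%:R.
  rewrite /zeta (eq_Ex Y_par (G := fun=> th%:R)) ?(Ex_cst Y_par) // => g [_ _ _ gp].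
  by rewrite gp //; congr _%:R; apply/minn_idPr/k_le.
have th_high : n%:R / 8 <= th%:R :> R.
  by move: i0_high; rewrite -(ler_nat R) natrM -/th; lra.
pose M := (p.+1 - i0).+1; pose t := (i - i0).+1.
have chord : t%:R * (th%:R - zeta i0.-1) <= M%:R * (zeta i - zeta i0.-1).
  have := @concave_above_chord R (fun l => zeta (i0.-1 + l)%N) M t.
  have -> : (i0.-1 + M = p.+1)%N by rewrite /M; nat_lia.
  have -> : (i0.-1 + t = i)%N by rewrite /t; nat_lia.
  rewrite addn0 zeta_top; apply; last by rewrite /M /t; nat_lia.
  move=> l lM; rewrite !addnS; apply: (mean_min_concave _ Y_par); first by rewrite /M in lM; nat_lia.
  by apply: k_mono; nat_lia.
have rise : mean i - mean z <= (i - z)%:R * slope i.-1.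
  by apply: (mean_sub_le R Y_par); nat_lia.
have tM : t%:R <= M%:R :> R by rewrite ler_nat /t /M; nat_lia.
have t32 : m%:R <= 32 * t%:R :> R by rewrite -natrM ler_nat.
have Mle : mu * M%:R <= 16 * m%:R.
  have := few_beyond i0_gt0 i0_le i0_high.
  have : M%:R <= 2 * (p.+1 - i0)%:R :> R by rewrite -natrM ler_nat /M; nat_lia.
  by move=> h1 h2; have := ler_wpM2l (ltW mu_gt0) h1; lra.
have zle : mu * (i - z)%:R <= 16 * m%:R.
  have h2 := few_beyond (ltn0Sn z) ltac:(nat_lia) zhigh.
  have : (i - z)%:R <= (p.+1 - z.+1)%:R :> R by rewrite ler_nat; nat_lia.
  by move=> h1; have := ler_wpM2l (ltW mu_gt0) h1; lra.
have t0 : 0 < t%:R :> R by rewrite ltr0n.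
have M0 : 0 < M%:R :> R by rewrite ltr0n.
have step1 : t%:R * (n%:R / 16) <= M%:R * ((i - z)%:R * slope i.-1).
  apply: (@le_trans _ _ (M%:R * (zeta i - zeta z))); last by rewrite ler_pM2l //; lra.
  apply: (@le_trans _ _ (t%:R * (th%:R - zeta z))); first by rewrite ler_pM2l //; lra.
  have : 0 <= (M%:R - t%:R) * (zeta i0.-1 - zeta z) by rewrite mulr_ge0 // subr_ge0.
  lra.
have s0 := slope_ge0 i.-1.
have step2 : mu ^+ 2 * (t%:R * (n%:R / 16)) <= (16 * m%:R) * ((16 * m%:R) * slope i.-1).
  apply: (@le_trans _ _ (mu * M%:R * (mu * (i - z)%:R * slope i.-1))).
    by have := ler_wpM2l (sqr_ge0 mu) step1; lra.
  by apply: ler_pM => //; [exact: mulr_ge0 (ltW _) (ltW _)|rewrite !mulr_ge0 // ltW|exact: ler_wpM2r].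
have step3 : mu ^+ 2 * (m%:R * n%:R) <= 2 ^+ 17 * m%:R ^+ 2 * slope i.-1.
  have : mu ^+ 2 * (n%:R * m%:R) <= mu ^+ 2 * (n%:R * (32 * t%:R)).
    by rewrite ler_wpM2l ?sqr_ge0 // ler_wpM2l // ltW.
  lra.
have m20 : 0 < 2 ^+ 17 * m%:R ^+ 2 :> R by rewrite mulr_gt0 ?exprn_gt0 ?ltr0n.
rewrite -(ler_pM2l m20); apply: le_trans step3.
rewrite le_eqVlt; apply/orP; left; apply/eqP.
by field; rewrite !gt_eqF.
Qed.

Variable A : pred nat.
Hypothesis A_many : (m <= 8 * count A (index_iota i0 p.+1))%N.

Let var_ge0 (i : nat) : 0 <= var i.
Proof. by apply: (Ex_ge0 Y_par) => g _; apply: sqr_ge0. Qed.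

Let far (i : nat) : bool := (m <= 32 * (i - i0).+1)%N.

Let count_far : (32 * count (predC far) (index_iota i0 p.+1) <= m)%N.
Proof.
suff : (count (predC far) (index_iota i0 p.+1) <= m %/ 32)%N by nat_lia.
by apply: count_window (i0) _ _ => i ii; rewrite /= /far => ?; nat_lia.
Qed.

(** At least [m / 16] sites of [A] are [far], and each has variance at least a quarter of its
    squared slope. *)
Lemma spread_of_slopes (c : R) : 0 <= c ->
  (forall i, (i0 <= i <= p)%N -> (m <= 32 * (i - i0).+1)%N -> c <= slope i.-1) ->
  c ^+ 2 * m%:R <= 64 * \sum_(i0 <= i < p.+1 | A i) var i.
Proof.
move=> c0 cs.
have := count_le_split A far (index_iota i0 p.+1); set N := count (predI _ _) _ => split.
have mN : (m <= 16 * N)%N by have := count_far; have := A_many; nat_lia.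
have h : N%:R * (c ^+ 2 / 4) <= \sum_(i0 <= i < p.+1 | A i) var i.
  apply: count_mul_le_sum => // i; rewrite mem_index_iota => /andP[i0i ip] fi.
  have ii : (i0 <= i <= p)%N by rewrite i0i.
  have := @var_ge_slope R W Om Y p q k Y_par i.-1 ltac:(nat_lia).
  have -> : i.-1.+1 = i by nat_lia.
  have := cs i ii fi => h.
  have : c ^+ 2 <= slope i.-1 ^+ 2 by rewrite ler_sqr ?nnegrE ?slope_ge0.
  lra.
have : c ^+ 2 * m%:R <= c ^+ 2 * (16 * N%:R).
  by rewrite ler_wpM2l ?sqr_ge0 // -natrM ler_nat.
lra.
Qed.

(** List the sites of [A] with low variance and controlled slopes, and cut the list into blocks of
    [2 * S] entries. Ends and middle of a block are automatically [S] apart, and with order [m / S]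
    blocks some block is both short and of small slope increment. *)
Lemma calm_window (S : nat) (c C V : R) : (0 < S)%N -> (128 <= m)%N -> (96 * S <= m)%N ->
  0 < V -> 0 < C -> 64 * \sum_(i0 <= i < p.+1 | A i) var i <= V * m%:R ->
  (forall i, (i0 <= i <= p)%N -> (m <= 32 * (i - i0).+1)%N -> c <= slope i.-1) ->
  (forall i, (i0 <= i <= p)%N -> (m <= 32 * (p - i))%N -> slope i.-1 <= C) ->
  exists lo j hi,
    [/\ (0 < lo)%N, (S <= j - lo)%N, (S <= hi - j)%N & (hi <= p)%N] /\
    [/\ var lo <= V, var j <= V, var hi <= V, c <= slope lo.-1 & slope hi.-1 <= C] /\
    mu * (hi - lo)%:R <= 2048 * S%:R /\
    m%:R * (slope hi.-1 - slope lo.-1) <= 256 * C * S%:R.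
Proof.
move=> S0 m128 mS V0 C0 sumV cs Cs.
pose near i := (m <= 32 * (p - i))%N.
pose low i := var i <= V.
pose gd := predI (predI (predI A far) near) low.
pose gs := seq.filter gd (index_iota i0 p.+1).
have near_count : (32 * count (predC near) (index_iota i0 p.+1) <= m + 32)%N.
  suff : (count (predC near) (index_iota i0 p.+1) <= (m %/ 32).+1)%N by nat_lia.
  by apply: (@count_window _ _ _ (p - m %/ 32)) => i ii; rewrite /= /near => ?; nat_lia.
have low_count : (64 * count (predI (predI (predI A far) near) (predC low)) (index_iota i0 p.+1) <= m)%N.
  rewrite -(ler_nat R) natrM -(ler_pM2r V0) [leRHS]mulrC; apply: le_trans sumV.
  rewrite -mulrA ler_pM2l //.
  apply: (@le_trans _ _ (\sum_(i0 <= i < p.+1 | predI (predI A far) near i) var i)).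
    apply: count_mul_le_sum => // i _; rewrite /= /low -ltNge; exact: ltW.
  rewrite big_mkcond [leRHS]big_mkcond; apply: ler_sum => i _ /=.
  by case: (A i) => //=; case: ifP.
(* Of at least [m / 8] sites, at most [m / 32] are not [far], [m / 32 + 1] not [near], and [m / 64]
   of the rest not [low]. *)
have gs_size : (m <= 32 * size gs)%N.
  rewrite size_filter.
  have h1 := count_le_split A far (index_iota i0 p.+1).
  have h2 := count_le_split (predI A far) near (index_iota i0 p.+1).
  have h3 : (count (predI (predI A far) near) (index_iota i0 p.+1) <= count gd (index_iota i0 p.+1) +
     count (predI (predI (predI A far) near) (predC low)) (index_iota i0 p.+1))%N.
    by rewrite /gd; elim: (index_iota _ _) => //= x s IH; case: (A x && _ && _); case: (low x) => /=; nat_lia.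
  by have := count_far; have := A_many; nat_lia.
have gsP t : (t < size gs)%N -> let i := nth 0%N gs t in
    [/\ (i0 <= i <= p)%N, far i, near i & low i].
  move=> /(mem_nth 0%N); rewrite mem_filter mem_index_iota => /andP[/andP[/andP[/andP[_ f] ne] lw] ii].
  by split => //; nat_lia.
have gs_sorted : sorted ltn gs.
  by apply: sorted_filter; [exact: ltn_trans|exact: iota_ltn_sorted].
have gs_gap t l : (t + l < size gs)%N -> (nth 0 gs t + l <= nth 0 gs (t + l))%N.
  elim: l => [|l IH] tl; first by rewrite !addn0.
  have : (nth 0%N gs (t + l) < nth 0%N gs (t + l).+1)%N.
    by apply: (sorted_ltn_nth ltn_trans 0%N gs_sorted); rewrite ?inE ?addnS in tl *; nat_lia.
  by have := IH ltac:(nat_lia); rewrite !addnS; nat_lia.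
pose Q := ((size gs).-1 %/ (2 * S))%N.
have Qsize : (2 * S * Q < size gs)%N.
  have : (Q * (2 * S) <= (size gs).-1)%N by apply: leq_trunc_div.
  by move: Q => Q; nat_lia.
have Q0 : (0 < Q)%N by rewrite divn_gt0; nat_lia.
have Qm : (m <= 128 * S * Q)%N.
  have : ((size gs).-1 < Q.+1 * (2 * S))%N by rewrite ltn_ceil; nat_lia.
  have : (Q.+1 * (2 * S) <= (2 * Q) * (2 * S))%N by rewrite leq_mul2r; apply/orP; right; nat_lia.
  rewrite (_ : 128 * S * Q = 32 * (2 * Q * (2 * S)))%N; last by ring.
  by move: (2 * Q * (2 * S))%N (Q.+1 * _)%N => u v; nat_lia.
pose g v := nth 0%N gs (2 * S * v).
have gP v : (v <= Q)%N -> [/\ (i0 <= g v <= p)%N, far (g v), near (g v) & low (g v)].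
  move=> vQ; apply: gsP; apply: leq_ltn_trans Qsize.
  by rewrite leq_mul2l vQ orbT.
have g_half v : (v < Q)%N -> [/\ (2 * S * v + S < size gs)%N, (2 * S * v + 2 * S < size gs)%N &
    g v.+1 = nth 0%N gs (2 * S * v + 2 * S)].
  move=> vQ; have : (2 * S * v.+1 <= 2 * S * Q)%N by rewrite leq_mul2l vQ orbT.
  by rewrite /g mulnS [(2 * S + _)%N]addnC => ?; split => //; nat_lia.
(* One potential for position and slope: both terms are nondecreasing in [v] and grow by at most 1
   in total, so a block where their sum grows slowly is good for both. *)
pose phi v : R := mu * (g v)%:R / (8 * m%:R) + slope (g v).-1 / C.
have mm : 0 < 8 * m%:R :> R by rewrite mulr_gt0.
have phi_total : phi Q - phi 0%N <= 2.
  have [/andP[a1 a2] _ _ _] := gP 0%N (leq0n _).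
  have [/andP[b1 b2] _ nb _] := gP Q (leqnn _).
  have d1 : (g Q)%:R - (g 0%N)%:R <= (p.+1 - i0)%:R :> R.
    by rewrite lerBlDr -natrD ler_nat; nat_lia.
  have d2 := few_beyond i0_gt0 i0_le i0_high.
  have d3 : mu * (g Q)%:R / (8 * m%:R) - mu * (g 0%N)%:R / (8 * m%:R) <= 1.
    rewrite -mulrBl ler_pdivrMr // mul1r -mulrBr.
    by apply: le_trans d2; rewrite ler_pM2l.
  have d4 : slope (g Q).-1 / C <= 1.
    by rewrite ler_pdivrMr // mul1r; apply: Cs => //; rewrite b1.
  have d5 : 0 <= slope (g 0%N).-1 / C by rewrite divr_ge0 ?slope_ge0 // ltW.
  by rewrite /phi; lra.
have [v vQ] := slow_step Q0 phi_total.
have [s1 s2 gS] := g_half v vQ.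
have [hlo flo _ vlo] := gP v (ltnW vQ).
have [hhi _ nhi vhi] := gP v.+1 vQ.
have [_ _ _ vj] := gsP _ s1.
have gap1 := gs_gap _ _ s1.
have gap2 : (nth 0 gs (2 * S * v + S) + S <= g v.+1)%N.
  by rewrite gS; have := gs_gap (2 * S * v + S)%N S; rewrite -addnA addnn -mul2n; apply.
have lohi : (g v <= g v.+1)%N by rewrite -/(g v) in gap1; nat_lia.
have {phi_total}Q0' : 0 < Q%:R :> R by rewrite ltr0n.
have Qm' : m%:R <= 128 * S%:R * Q%:R :> R by rewrite -!natrM ler_nat.
have slopes : slope (g v).-1 <= slope (g v.+1).-1 by apply: (slope_mono R Y_par); nat_lia.
rewrite /phi => step.
have dist0 : 0 <= mu * ((g v.+1)%:R - (g v)%:R) / (8 * m%:R).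
  by rewrite divr_ge0 ?(ltW mm) // mulr_ge0 ?(ltW mu_gt0) // subr_ge0 ler_nat.
have slope0 : 0 <= (slope (g v.+1).-1 - slope (g v).-1) / C.
  by rewrite divr_ge0 ?(ltW C0) // subr_ge0.
have {step}step : Q%:R * (mu * ((g v.+1)%:R - (g v)%:R) / (8 * m%:R)) +
    Q%:R * ((slope (g v.+1).-1 - slope (g v).-1) / C) <= 2 by lra.
exists (g v), (nth 0%N gs (2 * S * v + S)), (g v.+1); split; [|split; [|split]].
- by rewrite -/(g v) in gap1; split; nat_lia.
- split => //; first exact: cs.
  exact: Cs.
- have : Q%:R * (mu * ((g v.+1)%:R - (g v)%:R) / (8 * m%:R)) <= 2.
    by have := mulr_ge0 (ltW Q0') slope0; lra.
  rewrite mulrA ler_pdivrMr // -natrB // => h.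
  rewrite -(ler_pM2l Q0'); apply: (le_trans h); lra.
- have : Q%:R * ((slope (g v.+1).-1 - slope (g v).-1) / C) <= 2.
    by have := mulr_ge0 (ltW Q0') dist0; lra.
  rewrite mulrA ler_pdivrMr // => h.
  rewrite -(ler_pM2l Q0').
  have := ler_wpM2l (ltW m0) h => h'.
  have := ler_wpM2r (ltW C0) Qm' => h''.
  lra.
Qed.

End Spread.

(** Small variance limits [S]: the variance at [j] is at least of order [T * S ^ 2 / length ^ 2],
    where the mean rise [T] is at least [c] times the length and the length is of order [S / mu].
    The constant is 8 times 2048. *)
Lemma window_narrow (R : realType) (W : finType) (Om : {set W}) (Y : W -> nat -> nat)
    (p q : nat) (k : nat -> nat) (Y_par : parametrizes Om Y p q k)
    (k_mono : {homo k : i j / (i <= j)%N})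
    (lo j hi S H J : nat) (c C V mu xi : R) :
  (0 < lo)%N -> (0 < S)%N -> (S <= j - lo)%N -> (S <= hi - j)%N -> (hi <= p)%N ->
  (hi - lo <= J)%N -> 0 < c -> 0 < C -> 0 < mu ->
  var R Om Y lo <= V -> var R Om Y j <= V -> var R Om Y hi <= V ->
  c <= slope R Om Y lo.-1 -> slope R Om Y hi.-1 <= C ->
  mu * (hi - lo)%:R <= 2048 * S%:R ->
  slope R Om Y hi.-1 - slope R Om Y lo.-1 <= xi ->
  4 * (4 * V / c + J%:R * C) <= H%:R ->
  4 * (H%:R * (H.+1 ^ J)%:R * xi) <= c ->
  c * mu * S%:R <= 16384 * V.
Proof.
move=> lo0 S0 Sl Sr hip lenJ c0 C0 mu0 vlo vj vhi clo Chi len xiP HP XP.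
have V0 : 0 <= V.
  by apply: le_trans vj; apply: (Ex_ge0 Y_par) => g _; apply: sqr_ge0.
have S0' : 0 < S%:R :> R by rewrite ltr0n.
have loj : (lo < j)%N by nat_lia.
have jhi : (j < hi)%N by nat_lia.
have len1 : 1 <= (hi - lo)%:R :> R by rewrite ler1n; nat_lia.
have lenJ' : (hi - lo)%:R <= J%:R :> R by rewrite ler_nat.
set T := mean R Om Y hi - mean R Om Y lo.
have Tge : c * (hi - lo)%:R <= T.
  have lh : (lo <= hi <= p.+1)%N by nat_lia.
  have := mean_sub_ge R Y_par lh.
  have : slope R Om Y lo.-1 <= slope R Om Y lo by apply: (slope_mono R Y_par); nat_lia.
  rewrite -/T => h1 h2; apply: le_trans h2.
  by rewrite mulrC ler_wpM2l ?ler0n //; apply: le_trans h1.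
have Tle : T <= J%:R * C.
  have lh : (lo <= hi <= p.+1)%N by nat_lia.
  apply: (le_trans (mean_sub_le R Y_par lh)).
  apply: ler_pM => //; exact: (slope_ge0 _ Y_par).
have cT : c <= T by apply: le_trans Tge; rewrite ler_peMr // ltW.
have T0 : 0 < T by apply: lt_le_trans cT.
have HT : 4 * (4 * V + T ^+ 2) <= H%:R * T.
  apply: le_trans (ler_wpM2r (ltW T0) HP).
  have : 4 * V <= 4 * V / c * T.
    rewrite -mulrA ler_peMr ?mulr_ge0 //.
    by rewrite mulrC ler_pdivlMr // mul1r.
  have := ler_wpM2r (ltW T0) Tle; rewrite -expr2; lra.
have XT : 4 * (H%:R * (H.+1 ^ (hi - lo))%:R * (slope R Om Y hi.-1 - slope R Om Y lo.-1)) <= T.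
  apply: le_trans cT; apply: le_trans XP; rewrite ler_pM2l //.
  apply: ler_pM => //; first by rewrite mulr_ge0.
    by rewrite subr_ge0; apply: (slope_mono R Y_par); nat_lia.
  by rewrite ler_wpM2l // ler_nat leq_pexp2l.
have h1 := free_window_rise Y_par k_mono lo0 (ltn_trans loj jhi) hip vlo vhi HT XT.
have h2 := window_variance Y_par k_mono loj jhi hip (mean R Om Y j).
rewrite -/(var R Om Y j) in h2.
move: h1 h2; rewrite -/T; set E := Ex _ _ _ => h1 h2.
have SS : S%:R * S%:R <= (j - lo)%:R * (hi - j)%:R :> R.
  by rewrite -!natrM ler_nat leq_mul.
set ln : R := (hi - lo)%:R in len1 lenJ' Tge h2 len.
have ln0 : 0 < ln by apply: lt_le_trans len1.
have h3 : T * (S%:R * S%:R) <= 8 * ln ^+ 2 * V.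
  apply: (@le_trans _ _ (2 * (E * ((j - lo)%:R * (hi - j)%:R)))).
    by rewrite [leRHS]mulrA; apply: ler_pM => //; [exact: ltW|exact: mulr_ge0].
  have : 4 * ln ^+ 2 * var R Om Y j <= 4 * ln ^+ 2 * V.
    by rewrite ler_wpM2l // mulr_ge0 ?sqr_ge0.
  lra.
have h4 : ln * (c * (S%:R * S%:R)) <= ln * (8 * ln * V).
  have := ler_wpM2r (mulr_ge0 (ltW S0') (ltW S0')) Tge.
  by move: h3; rewrite expr2; lra.
rewrite ler_pM2l // in h4.
rewrite -(ler_pM2l S0').
have := ler_wpM2l (ltW mu0) h4.
have := ler_wpM2r V0 len.
lra.
Qed.

(** A predicate on [K], since one constant must serve all fibers of all posets. Here [m] and [n]
    stand for |A| and |B|, [p] and [q] for the sizes of the down-closure and its complement, and the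
    predicate [A] for the indices of the elements of the set A. *)
Definition spreads (R : realType) (mu L K : R) : Prop :=
  forall (W : finType) (Om : {set W}) (Y : W -> nat -> nat)
    (p q : nat) (k : nat -> nat) (m n i0 : nat) (A : pred nat),
  parametrizes Om Y p q k -> {homo k : i j / (i <= j)%N} ->
  (forall i, (k i <= q)%N) -> (0 < m)%N ->
  (forall i, (0 < i)%N -> (i <= p)%N -> mu * ((p.+1 - i)%:R * (k i)%:R) <= m%:R * n%:R) ->
  (0 < i0)%N -> (i0 <= p)%N -> (n <= 8 * k i0)%N ->
  (m <= 8 * count A (index_iota i0 p.+1))%N ->
  mu * m%:R <= n%:R -> K <= n%:R ->
  L * m%:R <= \sum_(i0 <= i < p.+1 | A i) var R Om Y i.

Lemma lattice_spread (R : realType) (mu L : R) : 0 < mu ->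
  exists K : R, spreads mu L K.
Proof.
move=> mu0.
(* If the sum of variances is below [L' * m], at most [m / 64] sites have variance above [V]. *)
pose L' : R := `|L| + 1; pose V : R := 64 * L'.
have L'0 : 0 < L' by rewrite ltr_wpDl.
have V0 : 0 < V by rewrite mulr_gt0.
pose c1 := mu ^+ 2 / 2 ^+ 17; pose C1 := 8192 / mu.
have c10 : 0 < c1 by rewrite divr_gt0 ?exprn_gt0.
have C10 : 0 < C1 by rewrite divr_gt0.
(* From this ratio of [n] to [m] on, the slope bound alone gives enough variance: [(c1 * s) ^+ 2] is
   at least [64 * L']. *)
pose K1 : R := 1 + 64 * L' / c1 ^+ 2.
have K11 : 1 <= K1 by rewrite lerDl divr_ge0 ?sqr_ge0 // mulr_ge0 // ltW.
have K10 : 0 < K1 by apply: lt_le_trans K11.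
pose c := c1 * mu; pose C := C1 * K1.
have c0 : 0 < c by rewrite mulr_gt0.
have C0 : 0 < C by rewrite mulr_gt0.
have cmu0 : 0 < c * mu by rewrite mulr_gt0.
(* Each choice depends on the earlier ones: [S] contradicts [window_narrow], [J] bounds the length
   of the calm window, [H] is the cutoff for rises, and [M] makes the slope increment small against
   [H.+1 ^ J]. *)
have [S SP] : exists S : nat, 16384 * V / (c * mu) < S%:R.
  by exists (Num.bound (16384 * V / (c * mu))); rewrite archi_boundP // divr_ge0 ?(ltW cmu0) // mulr_ge0 // ltW.
have S0' : 0 < S%:R :> R by apply: le_lt_trans SP; rewrite divr_ge0 ?(ltW cmu0) // mulr_ge0 // ltW.
have S0 : (0 < S)%N by move: S0'; rewrite ltr0n.
have [J JP] : exists J : nat, 2048 * S%:R / mu < J%:R.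
  by exists (Num.bound (2048 * S%:R / mu)); rewrite archi_boundP // divr_ge0 ?(ltW mu0) // mulr_ge0.
have [H HP] : exists H : nat, 4 * (4 * V / c + J%:R * C) < H%:R.
  exists (Num.bound (4 * (4 * V / c + J%:R * C))); rewrite archi_boundP // mulr_ge0 // addr_ge0 //.
    by rewrite divr_ge0 ?(ltW c0) // mulr_ge0 // ltW.
  by rewrite mulr_ge0 // ltW.
pose X : R := 1024 * (H%:R * (H.+1 ^ J)%:R * (C * S%:R)) / c.
have X0 : 0 <= X.
  have CS0 : 0 <= C * S%:R by rewrite mulr_ge0 // ltW.
  apply: divr_ge0; last exact: ltW.
  by rewrite mulr_ge0 // mulr_ge0 // mulr_ge0.
pose M := (Num.bound X + 96 * S + 128)%N.
(* When the ratio is below [K1], this bound on [n] forces [M <= m]. *)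
exists (1 + K1 * M%:R) => W Om Y p q k m n i0 A Y_par k_mono k_le m0 area i00 i0p high many mun Kn.
have m0' : 0 < m%:R :> R by rewrite ltr0n.
have n0 : (0 < n)%N.
  rewrite -(ltr_nat R); apply: lt_le_trans Kn.
  by rewrite ltr_pwDl // mulr_ge0 // ltW.
set s := n%:R / m%:R : R.
have smu : mu <= s by rewrite ler_pdivlMr.
have lower i : (i0 <= i <= p)%N -> (m <= 32 * (i - i0).+1)%N -> c1 * s <= slope R Om Y i.-1.
  exact: (slope_lower Y_par k_mono k_le mu0 m0 n0 area i00 i0p high).
have LL' : L <= L' by rewrite (le_trans (ler_norm L)) // lerDl.
apply: (@le_trans _ _ (L' * m%:R)); first by rewrite ler_wpM2r // ltW.
set Sig := \sum_(_ <= _ < _ | _) _.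
have [sbig|ssmall] := leP K1 s.
  have c1s0 : 0 <= c1 * s by rewrite mulr_ge0 ?(ltW c10) // (le_trans _ sbig) // ltW.
  have := spread_of_slopes Y_par m0 n0 i00 i0p high many c1s0 lower; rewrite -/Sig.
  have : 64 * L' <= (c1 * s) ^+ 2.
    rewrite exprMn.
    have : K1 <= s ^+ 2.
      by rewrite expr2 -[leLHS]mulr1; apply: ler_pM => //; [exact: ltW|exact: le_trans sbig].
    have c120 : 0 < c1 ^+ 2 by rewrite exprn_gt0.
    move=> /(ler_wpM2l (ltW c120)); apply: le_trans.
    have -> : c1 ^+ 2 * K1 = c1 ^+ 2 + 64 * L'.
      by rewrite /K1 [LHS]mulrDr mulr1; congr (_ + _); rewrite mulrC divfK // gt_eqF.
    by rewrite lerDr ltW.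
  move=> /(ler_wpM2r (ltW m0')) h1 h2.
  by have := le_trans h1 h2; rewrite -mulrA ler_pM2l.
rewrite leNgt; apply/negP => small.
have mM : M%:R <= m%:R :> R.
  rewrite -(ler_pM2l K10) ltW //.
  have : n%:R < K1 * m%:R by rewrite -ltr_pdivrMr.
  by apply: le_lt_trans; apply: le_trans Kn; rewrite lerDr.
have mM' : (M <= m)%N by rewrite ler_nat in mM.
have [|||||||lo [j [hi [[lo0 Sl Sr hip] [[vlo vj vhi clo Chi] [len xi]]]]]] :=
    @calm_window R W Om Y p q k Y_par mu m n mu0 m0 n0 area i0 i00 i0p high A many S c C V S0.
- by rewrite /M in mM'; nat_lia.
- by rewrite /M in mM'; nat_lia.
- exact: V0.
- exact: C0.
- by rewrite /V -mulrA ler_pM2l // ltW.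
- by move=> i ii fi; apply: le_trans (lower i ii fi); rewrite ler_pM2l.
- move=> i /andP[i0i ip] ne.
  have : slope R Om Y i.-1 <= C1 * s.
    by apply: (slope_upper Y_par (n := n) (m := m) (mu := mu)) => //; rewrite /M in mM'; nat_lia.
  by move=> /le_trans; apply; rewrite ler_pM2l // ltW.
have : c * mu * S%:R <= 16384 * V.
  apply: (window_narrow Y_par k_mono lo0 S0 Sl Sr hip _ c0 C0 mu0 vlo vj vhi clo Chi len
    (xi := 256 * C * S%:R / m%:R) (J := J) (H := H)).
  - rewrite -(ler_nat R) ltW //; apply: le_lt_trans JP.
    by rewrite ler_pdivlMr // mulrC.
  - by rewrite ler_pdivlMr // mulrC.
  - exact: ltW.
  have XM : X <= m%:R.
    apply: le_trans mM; rewrite /M !natrD -addrA ler_wpDr ?addr_ge0 //.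
    by rewrite ltW // archi_boundP.
  move: XM; rewrite /X ler_pdivrMr // => XM.
  have {}XM : 4 * (H%:R * (H.+1 ^ J)%:R * (256 * C * S%:R)) <= c * m%:R.
    rewrite [leRHS]mulrC; apply: le_trans XM; rewrite le_eqVlt; apply/orP; left; apply/eqP.
    by move: (H%:R * _) => z; ring.
  by rewrite [H%:R * _ * _]mulrA mulrA ler_pdivrMr.
by rewrite leNgt => /negP; apply; rewrite [ltRHS]mulrC -ltr_pdivrMr.
Qed.

(** * Linear extensions as paths *)

Lemma card_bounded_inj (T : finType) (S : {set T}) (h : T -> nat) (a l : nat) :
  {in S &, injective h} -> (forall x, x \in S -> (a <= h x < a + l)%N) -> (#|S| <= l)%N.
Proof.
move=> hinj hlt; rewrite cardE -(size_map h) -[leqRHS](size_iota a l).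
apply: uniq_leq_size.
  by rewrite map_inj_in_uniq ?enum_uniq // => x y; rewrite !mem_enum; apply: hinj.
by move=> _ /mapP[x + ->]; rewrite mem_enum mem_iota => /hlt.
Qed.

Lemma card_below (T : finType) (S : {set T}) (h : T -> nat) (i : nat) :
  {in S &, injective h} -> (forall x, x \in S -> (h x < #|S|)%N) -> (i <= #|S|)%N ->
  #|[set x in S | (h x < i)%N]| = i.
Proof.
move=> hinj hlt iS.
have below : (#|[set x in S | (h x < i)%N]| <= i)%N.
  apply: (card_bounded_inj (h := h) (a := 0)) => [x y|x]; rewrite !inE.
    by move=> /andP[xS _] /andP[yS _]; apply: hinj.
  by move=> /andP[].
have above : (#|[set x in S | (i <= h x)%N]| <= #|S| - i)%N.
  apply: (card_bounded_inj (h := h) (a := i)) => [x y|x]; rewrite !inE.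
    by move=> /andP[xS _] /andP[yS _]; apply: hinj.
  by move=> /andP[xS ->]; rewrite subnKC // hlt.
have : (#|S| <= #|[set x in S | (h x < i)%N]| + #|[set x in S | (i <= h x)%N]|)%N.
  apply: leq_trans (leq_card_setU _ _); apply: subset_leq_card.
  by apply/fintype.subsetP => x xS; rewrite !inE xS /=; case: ltnP.
lia.
Qed.

Definition rank_in (T : finType) (S : {set T}) (h : T -> nat) (x : T) : nat :=
  #|[set z in S | (h z < h x)%N]|.

Section Rank.
Variables (T : finType) (S : {set T}) (h : T -> nat).

Lemma rank_in_mono (x y : T) : (h x <= h y)%N -> (rank_in S h x <= rank_in S h y)%N.
Proof.
move=> xy; apply: subset_leq_card; apply/fintype.subsetP => z.
by rewrite !inE => /andP[-> zx]; apply: leq_trans xy.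
Qed.

Lemma rank_in_lt (x y : T) : x \in S -> (rank_in S h x < rank_in S h y)%N = (h x < h y)%N.
Proof.
move=> xS; case: (ltnP (h x) (h y)) => xy; last by apply/negbTE; rewrite -leqNgt rank_in_mono.
apply: proper_card; apply/properP; split.
  by apply/fintype.subsetP => z; rewrite !inE => /andP[-> zx]; apply: ltn_trans xy.
by exists x; rewrite !inE ?xS ?xy // ltnn andbF.
Qed.

Lemma rank_in_lt_card (x : T) : x \in S -> (rank_in S h x < #|S|)%N.
Proof.
move=> xS; apply: proper_card; apply/properP; split.
  by apply/fintype.subsetP => z; rewrite !inE => /andP[].
by exists x; rewrite // !inE ltnn andbF.
Qed.

Lemma rank_in_le_card (x : T) : (rank_in S h x <= #|S|)%N.
Proof. by apply: subset_leq_card; apply/fintype.subsetP => z; rewrite !inE => /andP[]. Qed.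

Lemma rank_in_inj : {in S &, injective h} -> {in S &, injective (rank_in S h)}.
Proof.
move=> hinj x y xS yS xy; apply: hinj => //.
have := rank_in_lt y xS; have := rank_in_lt x yS.
by rewrite xy ltnn; case: ltngtP.
Qed.

Lemma card_rank_below (i : nat) : {in S &, injective h} -> (i <= #|S|)%N ->
  #|[set x in S | (rank_in S h x < i)%N]| = i.
Proof. by move=> hinj; apply: card_below => //; [exact: rank_in_inj|exact: rank_in_lt_card]. Qed.

Lemma initial_segment (U : {set T}) : U \subset S ->
  (forall y z, y \in U -> z \in S -> (h z <= h y)%N -> z \in U) ->
  forall y, y \in S -> (y \in U) = (rank_in S h y < #|U|)%N.
Proof.
move=> /fintype.subsetP US Udown y yS; case: (boolP (y \in U)) => yU; apply/esym.
  apply: proper_card; apply/properP; split.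
    apply/fintype.subsetP => z; rewrite !inE => /andP[zS zy].
    exact: Udown yU zS (ltnW zy).
  by exists y; rewrite // !inE ltnn andbF.
apply/negbTE; rewrite -leqNgt; apply: subset_leq_card.
apply/fintype.subsetP => z zU; rewrite !inE US //= ltnNge; apply/negP => yz.
by move: yU; rewrite (Udown z).
Qed.

End Rank.

(** * Linear extensions with prescribed restrictions to a down-set and its complement *)

Section Fiber.
Variables (d : Order.disp_t) (P : finPOrderType d).
Local Notation linext := (@linear_extension d P).

Lemma linext_inj (f : {ffun P -> 'I_#|P|}) : linext f -> injective (fun x => nat_of_ord (f x)).
Proof.
by move=> /linear_extensionP[fb _] x y /val_inj; apply: bij_inj.
Qed.

Lemma linext_lt (f : {ffun P -> 'I_#|P|}) (x y : P) :
  linext f -> (x < y)%O -> (f x < f y)%N.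
Proof.
move=> fl xy; have /linear_extensionP[_ fH] := fl.
rewrite ltn_neqAle fH ?ltW // andbT; apply/eqP => /(linext_inj fl) E.
by move: xy; rewrite E ltxx.
Qed.

Lemma linext_rank (f : {ffun P -> 'I_#|P|}) (x : P) :
  linext f -> #|[set z | (f z < f x)%N]| = f x.
Proof.
move=> fl; rewrite -[RHS](@card_below P [set: P] (fun x => nat_of_ord (f x)) (f x)).
- by apply: eq_card => z; rewrite !inE.
- by move=> y z _ _; apply: (linext_inj fl).
- by move=> z _; rewrite cardsT; apply: ltn_ord.
- by rewrite cardsT ltnW.
Qed.

(** An extension can be given by arbitrary integer keys; passing to ranks brings them into the right
    range. *)
Lemma linext_of_key (kappa : P -> nat) : injective kappa ->
  {homo kappa : x y / (x < y)%O >-> (x < y)%N} ->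
  exists2 f : {ffun P -> 'I_#|P|}, linext f &
    forall x y, (f x < f y)%N = (kappa x < kappa y)%N.
Proof.
move=> kinj khomo.
have rk x : (rank_in [set: P] kappa x < #|P|)%N.
  by rewrite -cardsT rank_in_lt_card.
pose f := [ffun x => Ordinal (rk x)].
have fE x y : (f x < f y)%N = (kappa x < kappa y)%N.
  by rewrite !ffunE /= rank_in_lt.
exists f => //; apply/andP; split.
  apply/injectiveP => x y xy; apply: kinj.
  by have := fE x y; have := fE y x; rewrite xy ltnn; case: ltngtP.
apply/forallP => x; apply/forallP => y; apply/implyP; rewrite le_eqVlt => /orP[/eqP ->//|xy].
by apply: ltnW; rewrite fE khomo.
Qed.

Lemma linext_exists : exists f : {ffun P -> 'I_#|P|}, linext f.
Proof.
(* Strict down-sets grow along the order; [enum_rank] breaks ties. *)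
pose kappa (x : P) := (#|[set z : P | (z < x)%O]| * #|P|.+1 + enum_rank x)%N.
have rk (x : P) : (enum_rank x < #|P|)%N by [].
have [x y|x y xy|f fl _] := @linext_of_key kappa; last by exists f.
  rewrite /kappa => E; apply: enum_rank_inj; apply: val_inj => /=.
  have := congr1 (fun u => u %% #|P|.+1)%N E.
  by rewrite !modnMDl !modn_small // ltnS ltnW.
rewrite /kappa.
have : (#|[set z : P | (z < x)%O]| < #|[set z : P | (z < y)%O]|)%N.
  apply: proper_card; apply/properP; split.
    by apply/fintype.subsetP => z; rewrite !inE => /lt_trans; apply.
  by exists x; rewrite !inE ?ltxx.
move=> lxy; apply: (@leq_trans (#|[set z : P | (z < x)%O]|.+1 * #|P|.+1)).
  by rewrite mulSn addnC ltn_add2r ltnS ltnW.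
by apply: leq_trans (leq_addr _ _); rewrite leq_mul2r lxy orbT.
Qed.

Variable X : {set P}.
Hypothesis X_down : forall x y, y \in X -> (x <= y)%O -> x \in X.

(** Only the relative order on each side of [X] is fixed, since positions change with the
    interleaving. *)
Definition fiber (f0 : {ffun P -> 'I_#|P|}) : {set {ffun P -> 'I_#|P|}} :=
  [set f | linext f && [forall x, forall y, ((x \in X) == (y \in X)) ==>
                          ((f x < f y)%N == (f0 x < f0 y)%N)]].

Lemma fiberP (f0 f : {ffun P -> 'I_#|P|}) :
  reflect (linext f /\ forall x y, (x \in X) = (y \in X) -> (f x < f y)%N = (f0 x < f0 y)%N)
          (f \in fiber f0).
Proof.
rewrite inE; apply: (iffP andP) => -[fl H]; split => //.
  by move=> x y /eqP xy; move/forallP: H => /(_ x)/forallP/(_ y)/implyP/(_ xy)/eqP.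
by apply/forallP => x; apply/forallP => y; apply/implyP => /eqP xy; rewrite H.
Qed.

Lemma mem_fiber (f0 : {ffun P -> 'I_#|P|}) : linext f0 -> f0 \in fiber f0.
Proof. by move=> ?; apply/fiberP. Qed.

Lemma fiber_eq (f0 f : {ffun P -> 'I_#|P|}) : f \in fiber f0 -> fiber f = fiber f0.
Proof.
move=> /fiberP[fl fH]; apply/setP => g; apply/fiberP/fiberP => -[gl gH]; split => // x y xy.
  by rewrite gH // fH.
by rewrite gH // fH.
Qed.

(** Fibers are equivalence classes. Summing over all [f0] avoids representatives: each [f] is
    counted once by every member of its class. *)
Lemma sum_fiber (R : realFieldType) (Phi : {ffun P -> 'I_#|P|} -> R) :
  \sum_(f | linext f) Phi f =
  \sum_(f0 | linext f0) (\sum_(f in fiber f0) Phi f) / #|fiber f0|%:R.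
Proof.
under [RHS]eq_bigr do rewrite mulr_suml.
rewrite (exchange_big_dep linext) /=; last by move=> f0 f _ /fiberP[].
apply: eq_bigr => f fl.
rewrite (eq_bigl (fun f0 => f0 \in fiber f)) => [|f0]; last first.
  apply/andP/idP => [[f0l ff0]|f0f].
    by rewrite (fiber_eq ff0) mem_fiber.
  have /fiberP[f0l _] := f0f; split => //.
  by rewrite (fiber_eq f0f) mem_fiber.
rewrite (eq_bigr (fun=> Phi f / #|fiber f|%:R)) => [|f0 f0f]; last by rewrite (fiber_eq f0f).
rewrite sumr_const -[_ *+ _]mulr_natr divfK // pnatr_eq0 -lt0n card_gt0.
by apply/finset.set0Pn; exists f; apply: mem_fiber.
Qed.

End Fiber.

(** * The bijection between a fiber and the admissible paths *)

Section Heights.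
Variables (d : Order.disp_t) (P : finPOrderType d).
Local Notation linext := (@linear_extension d P).
Local Notation pos f := (fun x : P => nat_of_ord (f x)).
Variable X : {set P}.
Hypothesis X_down : forall x y, y \in X -> (x <= y)%O -> x \in X.
Variable f0 : {ffun P -> 'I_#|P|}.
Hypothesis f0_lin : linext f0.

Let rX := rank_in X (pos f0).
Let rY := rank_in (~: X) (pos f0).

Definition below (f : {ffun P -> 'I_#|P|}) (y : P) : nat :=
  #|[set x in X | (f x < f y)%N]|.

(* The number of elements outside [X] that precede the [i]-th element of [X],
   counting from [1]. *)
Definition height (f : {ffun P -> 'I_#|P|}) (i : nat) : nat :=
  #|[set y in ~: X | (below f y < i)%N]|.

(** The elements that may precede the [i]-th element of [X]; [rX] counts from 0, hence [i.-1].
    Quantifying over all [z] up to [y] makes this an initial segment of the complement, so its size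
    determines it. *)
Definition barrier_set (i : nat) : {set P} :=
  [set y in ~: X | [forall x, forall z,
     [&& x \in X, z \in ~: X, (i.-1 <= rX x)%N & (f0 z <= f0 y)%N] ==> ~~ (x < z)%O]].

Definition barrier (i : nat) : nat := #|barrier_set i|.

Lemma barrier_setP (i : nat) (y : P) :
  reflect (y \notin X /\ forall x z, x \in X -> z \notin X -> (i.-1 <= rX x)%N ->
             (f0 z <= f0 y)%N -> ~~ (x < z)%O)
          (y \in barrier_set i).
Proof.
rewrite !inE; apply: (iffP andP) => -[yX H]; split => //.
  move=> x z xX zX ix zy; move/forallP: H => /(_ x)/forallP/(_ z)/implyP; apply.
  by rewrite xX inE zX ix.
apply/forallP => x; apply/forallP => z; apply/implyP => /and4P[xX].
by rewrite inE => zX ix zy; apply: H.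
Qed.

Lemma barrier_mono : {homo barrier : i j / (i <= j)%N}.
Proof.
move=> i j ij; apply: subset_leq_card; apply/fintype.subsetP => y /barrier_setP[yX H].
apply/barrier_setP; split => // x z xX zX jx; apply: H => //.
by apply: leq_trans jx; nat_lia.
Qed.

Lemma barrier_le (i : nat) : (barrier i <= #|~: X|)%N.
Proof.
by apply: subset_leq_card; apply/fintype.subsetP => y; rewrite !inE => /andP[].
Qed.

Lemma barrier_initial (i : nat) (y : P) : y \notin X ->
  (y \in barrier_set i) = (rY y < barrier i)%N.
Proof.
move=> yX; apply: initial_segment; rewrite ?inE //.
  by apply/fintype.subsetP => z /barrier_setP[zX _]; rewrite inE.
move=> {yX}y z /barrier_setP[yX H]; rewrite inE => zX zy; apply/barrier_setP; split => //.
by move=> x w xX wX ix wz; apply: H => //; apply: leq_trans zy.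
Qed.

Lemma barrier_incomparable (i : nat) :
  incomparable_pair [set x in X | (i.-1 <= rX x)%N] (barrier_set i).
Proof.
split.
  apply/fintype.pred0P => x /=; apply/negbTE; rewrite negb_and !inE.
  by case: (x \in X) => //=; rewrite orbT.
move=> x y; rewrite inE => /andP[xX ix] /barrier_setP[yX H].
apply/negP => /orP[|yx]; last by move: yX; rewrite (X_down xX yx).
rewrite le_eqVlt => /orP[/eqP xy|xy]; first by move: yX; rewrite -xy xX.
by have := H x y xX yX ix (leqnn _); rewrite xy.
Qed.

Lemma card_tail (i : nat) : (0 < i)%N -> (i <= #|X|)%N ->
  #|[set x in X | (i.-1 <= rX x)%N]| = (#|X|.+1 - i)%N.
Proof.
move=> i0 iX; have := cardsID [set x | (rX x < i.-1)%N] X.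
have -> : X :&: [set x | (rX x < i.-1)%N] = [set x in X | (rX x < i.-1)%N].
  by apply/setP => x; rewrite !inE.
have -> : X :\: [set x | (rX x < i.-1)%N] = [set x in X | (i.-1 <= rX x)%N].
  by apply/setP => x; rewrite !inE -leqNgt andbC.
rewrite card_rank_below; [nat_lia|exact: in2W (linext_inj f0_lin)|nat_lia].
Qed.

Section InFiber.
Variable f : {ffun P -> 'I_#|P|}.
Hypothesis f_fib : f \in fiber X f0.

Let f_lin : linext f. Proof. by case/fiberP: f_fib. Qed.

Let f_same (x y : P) : (x \in X) = (y \in X) -> (f x < f y)%N = (f0 x < f0 y)%N.
Proof. by case/fiberP: f_fib => _; apply. Qed.

Lemma rank_fiber (x : P) : x \in X -> rank_in X (pos f) x = rX x.
Proof.
move=> xX; apply: eq_card => z; rewrite !inE; case: (boolP (z \in X)) => //= zX.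
by rewrite f_same // xX zX.
Qed.

Lemma rank_fiberC (y : P) : y \notin X -> rank_in (~: X) (pos f) y = rY y.
Proof.
move=> yX; apply: eq_card => z; rewrite !inE; case: (boolP (z \in X)) => //= zX.
by rewrite f_same // (negbTE yX) (negbTE zX).
Qed.

Lemma below_gt (x y : P) : x \in X -> (rX x < below f y)%N = (f x < f y)%N.
Proof.
move=> xX; rewrite -rank_fiber //; case: (ltnP (f x) (f y)) => xy.
  apply: proper_card; apply/properP; split.
    by apply/fintype.subsetP => z; rewrite !inE => /andP[-> zx]; apply: ltn_trans xy.
  by exists x; rewrite !inE ?xX ?xy // ltnn andbF.
apply/negbTE; rewrite -leqNgt; apply: subset_leq_card; apply/fintype.subsetP => z.
by rewrite !inE => /andP[-> zy]; apply: leq_trans xy.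
Qed.

Lemma card_before (w : P) :
  nat_of_ord (f w) = (#|[set z in X | (f z < f w)%N]| + #|[set z in ~: X | (f z < f w)%N]|)%N.
Proof.
rewrite -[LHS](linext_rank w f_lin) -(cardsID X); congr (_ + _)%N;
  by apply: eq_card => z; rewrite !inE; case: (z \in X); rewrite ?andbT ?andbF.
Qed.

(** In a fiber the rank is constant, so positions of elements of [X] fluctuate exactly as heights
    do. *)
Lemma position_in (x : P) : x \in X -> nat_of_ord (f x) = (rX x + height f (rX x).+1)%N.
Proof.
move=> xX; rewrite card_before -(rank_fiber xX); congr (_ + _)%N; apply: eq_card => y.
rewrite !inE; case: (boolP (y \in X)) => //= yX.
rewrite rank_fiber // [RHS]ltnS [RHS]leqNgt below_gt // -leqNgt [RHS]leq_eqVlt.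
case: eqP => // /(linext_inj f_lin) E; by move: yX; rewrite E xX.
Qed.

Lemma position_out (y : P) : y \notin X -> nat_of_ord (f y) = (rY y + below f y)%N.
Proof. by move=> yX; rewrite card_before addnC -(rank_fiberC yX). Qed.

Lemma height_initial (i : nat) (y : P) : y \notin X ->
  (below f y < i)%N = (rY y < height f i)%N.
Proof.
move=> yX; have yC : y \in ~: X by rewrite inE.
rewrite -(@initial_segment _ _ _ [set y in ~: X | (below f y < i)%N]) //.
- by rewrite !inE yX.
- by apply/fintype.subsetP => z; rewrite !inE => /andP[].
move=> u z; rewrite !inE => /andP[uX ui] zX zu; rewrite zX /=.
apply: leq_ltn_trans ui; apply: subset_leq_card; apply/fintype.subsetP => x.
rewrite !inE => /andP[-> xz] /=; apply: leq_trans xz _.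
by rewrite leqNgt f_same ?(negbTE uX) ?(negbTE zX) // -leqNgt.
Qed.

Lemma admissible_height : admissible #|X| #|~: X| barrier (height f).
Proof.
split=> [|i j ij|i|i pi].
- by apply/eqP; rewrite cards_eq0; apply/eqP/setP => y; rewrite !inE andbF.
- apply: subset_leq_card; apply/fintype.subsetP => y; rewrite !inE => /andP[-> yi].
  by apply: leq_trans ij.
- apply: subset_leq_card; apply/fintype.subsetP => y; rewrite !inE => /andP[yX yi].
  have : y \in barrier_set i; last by rewrite !inE.
  apply/barrier_setP; split => // x z xX zX ix zy; apply/negP => xz.
  have fxz := linext_lt f_lin xz.
  have fzy : (f z <= f y)%N by rewrite leqNgt f_same ?(negbTE yX) ?(negbTE zX) // -leqNgt.
  have : (f x < f y)%N by apply: leq_trans fzy.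
  by rewrite -below_gt //; nat_lia.
- apply: eq_card => y; rewrite !inE; case: (boolP (y \in X)) => //= yX.
  apply: leq_ltn_trans pi; apply: subset_leq_card.
  by apply/fintype.subsetP => z; rewrite !inE => /andP[].
Qed.

End InFiber.

(** Heights give the positions in [X] directly; outside [X] they determine [below], which is their
    generalized inverse. *)
Lemma height_inj : {in fiber X f0 &, injective height}.
Proof.
move=> f g fF gF fg; apply/ffunP => w; apply: val_inj => /=.
case: (boolP (w \in X)) => wX; first by rewrite !position_in // fg.
rewrite !position_out //; congr (_ + _)%N.
have E i : (below f w < i)%N = (below g w < i)%N.
  by rewrite (height_initial fF i wX) (height_initial gF i wX) fg.
have := E (below f w).+1; have := E (below g w).+1.
by rewrite !ltnSn ltnS => h1 /esym; rewrite ltnS => h2; apply/eqP; rewrite eqn_leq h1.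
Qed.

Lemma height_surj (g : nat -> nat) : admissible #|X| #|~: X| barrier g ->
  exists2 f, f \in fiber X f0 & height f = g.
Proof.
move=> [g0 gmono gle gtop]; pose N := #|P|.
(* Two digits in base [N.+1]. The leading one counts the elements outside [X] that come before; the
   last digit [N] places an outside element after all elements of [X] with the same leading
   digit. *)
pose kappa w := if w \in X then (g (rX w).+1 * N.+1 + rX w)%N else (rY w * N.+1 + N)%N.
have f0i (S : {set P}) : {in S &, injective (pos f0)} by exact: in2W (linext_inj f0_lin).
have rXN w : (rX w < N.+1)%N.
  by rewrite ltnS; apply: leq_trans (rank_in_le_card _ _ _) (max_card _).
have ltXX x x' : x \in X -> x' \in X -> (f0 x < f0 x')%N -> (kappa x < kappa x')%N.
  move=> xX x'X xx'; rewrite /kappa xX x'X.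
  have rr : (rX x < rX x')%N by rewrite rank_in_lt.
  have : (g (rX x).+1 * N.+1 <= g (rX x').+1 * N.+1)%N by rewrite leq_mul2r (gmono _ _ (leqW rr)) orbT.
  by move: (g _ * _)%N (g _ * _)%N => a b; nat_lia.
have ltYY y y' : y \notin X -> y' \notin X -> (f0 y < f0 y')%N -> (kappa y < kappa y')%N.
  move=> yX y'X yy'; rewrite /kappa (negbTE yX) (negbTE y'X).
  have rr : (rY y < rY y')%N by rewrite rank_in_lt // inE.
  by rewrite ltn_add2r ltn_mul2r.
have ltXY x y : x \in X -> y \notin X -> (g (rX x).+1 <= rY y)%N -> (kappa x < kappa y)%N.
  move=> xX yX gr; rewrite /kappa xX (negbTE yX).
  have : (g (rX x).+1 * N.+1 <= rY y * N.+1)%N by rewrite leq_mul2r gr orbT.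
  have : (rX x < N)%N by apply: leq_trans (rank_in_lt_card _ xX) (max_card _).
  by move: (_ * _)%N (rY y * _)%N => a b; nat_lia.
have ltYX x y : x \in X -> y \notin X -> (rY y < g (rX x).+1)%N -> (kappa y < kappa x)%N.
  move=> xX yX gr; rewrite /kappa xX (negbTE yX).
  have : ((rY y).+1 * N.+1 <= g (rX x).+1 * N.+1)%N by rewrite leq_mul2r gr orbT.
  by rewrite mulSn; move: (g _ * _)%N (rY y * _)%N => a b; nat_lia.
have eqXX x x' : (x \in X) = (x' \in X) -> (kappa x < kappa x')%N = (f0 x < f0 x')%N.
  move=> E; have lt u v : (u \in X) = (v \in X) -> (f0 u < f0 v)%N -> (kappa u < kappa v)%N.
    case: (boolP (u \in X)) => uX /esym vX; first by apply: ltXX.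
    by apply: ltYY; rewrite ?vX.
  have [xx'|xx'|/(linext_inj f0_lin) ->] := ltngtP (f0 x) (f0 x'); last by rewrite ltnn.
    exact: lt.
  by apply/negbTE; rewrite -leqNgt ltnW // lt.
have eqXY x y : x \in X -> y \notin X -> (kappa x < kappa y)%N = (g (rX x).+1 <= rY y)%N.
  move=> xX yX; case: (leqP (g (rX x).+1) (rY y)) => gr; first exact: ltXY.
  by apply/negbTE; rewrite -leqNgt ltnW // ltYX.
have kinj : injective kappa.
  move=> u v uv; case: (boolP (u \in X)) => uX; case: (boolP (v \in X)) => vX.
  - have E : (u \in X) = (v \in X) by rewrite uX vX.
    have := eqXX u v E; have := eqXX v u (esym E); rewrite uv ltnn.
    by case: ltngtP => // /(linext_inj f0_lin).
  - case: (leqP (g (rX u).+1) (rY v)) => gr; first by have := ltXY _ _ uX vX gr; rewrite uv ltnn.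
    by have := ltYX _ _ uX vX gr; rewrite uv ltnn.
  - case: (leqP (g (rX v).+1) (rY u)) => gr; first by have := ltXY _ _ vX uX gr; rewrite uv ltnn.
    by have := ltYX _ _ vX uX gr; rewrite uv ltnn.
  - have E : (u \in X) = (v \in X) by rewrite (negbTE uX) (negbTE vX).
    have := eqXX u v E; have := eqXX v u (esym E); rewrite uv ltnn.
    by case: ltngtP => // /(linext_inj f0_lin).
have khomo : {homo kappa : x y / (x < y)%O >-> (x < y)%N}.
  move=> u v uv; have f0uv := linext_lt f0_lin uv.
  case: (boolP (u \in X)) => uX; case: (boolP (v \in X)) => vX.
  - exact: ltXX.
  - apply: ltXY => //; apply: (leq_trans (gle _)); rewrite leqNgt -barrier_initial //.
    apply/negP => /barrier_setP[_ /(_ u v uX vX)]; rewrite /= uv => H.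
    by have := H (leqnn _) (leqnn _).
  - by move: uX; rewrite (X_down vX (ltW uv)).
  - exact: ltYY.
have [f fl fE] := linext_of_key kinj khomo.
have fF : f \in fiber X f0 by apply/fiberP; split => // x y xy; rewrite fE eqXX.
exists f => //; apply/funext => i.
have [hf0 _ _ hftop] := admissible_height fF.
have [->|i0] := posnP i; first by rewrite hf0 g0.
have [iX|iX] := ltnP #|X| i; first by rewrite hftop // gtop.
have gi : (g i <= #|~: X|)%N by apply: leq_trans (gle i) (barrier_le i).
rewrite -[RHS](card_rank_below (f0i _) gi); apply: eq_card => y.
rewrite !inE; case: (boolP (y \in X)) => //= yX.
rewrite -/rY; case: (ltnP (rY y) (g i)) => gy.
  apply: (@leq_ltn_trans i.-1); last by nat_lia.
  rewrite -[leqRHS](@card_rank_below _ X (pos f0)) //; last by nat_lia.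
  apply: subset_leq_card; apply/fintype.subsetP => x; rewrite !inE => /andP[xX].
  rewrite fE eqXY // xX /= -/rX => gx; rewrite ltnNge; apply/negP => ix.
  have : (g i <= g (rX x).+1)%N by apply: gmono; nat_lia.
  by move=> h; have := leq_ltn_trans (leq_trans h gx) gy; rewrite ltnn.
apply/negbTE; rewrite -leqNgt -[leqLHS](@card_rank_below _ X (pos f0)) //.
apply: subset_leq_card; apply/fintype.subsetP => x; rewrite !inE => /andP[xX xi].
by rewrite xX fE eqXY //=; apply: leq_trans gy; apply: gmono.
Qed.

Lemma height_parametrizes : parametrizes (fiber X f0) height #|X| #|~: X| barrier.
Proof.
split; [|exact: admissible_height|exact: height_inj|exact: height_surj].
by apply/card_gt0P; exists f0; apply: mem_fiber.
Qed.

End Heights.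

Lemma ler_sum_subset (R : realFieldType) (T : eqType) (s t : seq T) (F : T -> R) :
  uniq s -> uniq t -> {subset s <= t} -> (forall i, 0 <= F i) ->
  \sum_(i <- s) F i <= \sum_(i <- t) F i.
Proof.
move=> us ut st F0.
have perm : perm_eq s [seq i <- t | i \in s].
  apply: uniq_perm; rewrite ?filter_uniq // => i; rewrite mem_filter.
  by case: (boolP (i \in s)) => //= /st ->.
rewrite (perm_big _ perm) big_filter big_mkcond; apply: ler_sum => i _.
by case: ifP.
Qed.

Lemma var_le (R : realType) (W : finType) (Om : {set W}) (Y : W -> nat -> nat)
    (p q : nat) (k : nat -> nat) (Y_par : parametrizes Om Y p q k) (i : nat) (c : R) :
  var R Om Y i <= Ex Om Y (fun g => ((g i)%:R - c) ^+ 2).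
Proof.
set e := mean R Om Y i.
rewrite (eq_Ex Y_par (F := fun g => ((g i)%:R - c) ^+ 2) (G := fun g =>
  ((g i)%:R - e) ^+ 2 + (2 * (e - c) * ((g i)%:R - e) + (e - c) ^+ 2))); last first.
  by move=> g _; ring.
rewrite !ExD ExZ ExB !(Ex_cst Y_par) -/(mean R Om Y i) -/e subrr mulr0 add0r.
by rewrite lerDl sqr_ge0.
Qed.

(** * Spread within one fiber, and averaging over linear extensions *)

Section Inversions.
Variables (d : Order.disp_t) (P : finPOrderType d) (R : realType).
Local Notation linext := (@linear_extension d P).
Implicit Types (A B : {set P}) (f : {ffun P -> 'I_#|P|}).

Definition inversions A B f : nat := \sum_(a in A) #|[set b in B | (f b < f a)%N]|.

Definition down_closure A : {set P} := [set x | [exists a in A, (x <= a)%O]].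

Lemma down_closureP A x : reflect (exists2 a, a \in A & (x <= a)%O) (x \in down_closure A).
Proof. by rewrite inE; apply: exists_inP. Qed.

Lemma down_closure_down A x y : y \in down_closure A -> (x <= y)%O -> x \in down_closure A.
Proof.
by move=> /down_closureP[a aA ya] xy; apply/down_closureP; exists a => //; apply: le_trans ya.
Qed.

Lemma sub_down_closure A : A \subset down_closure A.
Proof. by apply/fintype.subsetP => a aA; apply/down_closureP; exists a. Qed.

Lemma incomparable_down_closure A B b : incomparable_pair A B -> b \in B -> b \notin down_closure A.
Proof.
move=> [_ AB] bB; apply/down_closureP => -[a aA ba].
by have := AB a b aA bB; rewrite /Order.comparable ba orbT.
Qed.

(** A reverse Markov inequality: if a quarter of all pairs are inverted, an eighth of [A] has an
    eighth of [B] before it. *)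
Lemma many_high A B f : (0 < #|B|)%N -> (#|A| * #|B| <= 4 * inversions A B f)%N ->
  (#|A| <= 8 * #|[set a in A | (#|B| <= 8 * #|[set b in B | (f b < f a)%N]|)%N]|)%N.
Proof.
move=> B0 inv; set H := [set a in A | _].
have le_B (a : P) : (#|[set b in B | (f b < f a)%N]| <= #|B|)%N.
  by apply: subset_leq_card; apply/fintype.subsetP => b; rewrite !inE => /andP[].
have : (8 * inversions A B f <= \sum_(a in A) (8 * #|B| * (a \in H) + #|B|))%N.
  rewrite /inversions big_distrr; apply: leq_sum => a aA; rewrite /H inE aA /=.
  have := le_B a; move: #|[set b in B | _]| => u uB.
  case: (leqP #|B| (8 * u)) => h; last by rewrite muln0 add0n ltnW.
  by apply: leq_trans (leq_addr _ _); rewrite muln1 leq_mul2l uB.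
rewrite big_split /= -big_distrr /= sum_nat_const.
have -> : (\sum_(a in A) (a \in H) = #|H|)%N.
  rewrite -sum1_card big_mkcond [RHS]big_mkcond /=; apply: eq_bigr => a _.
  by rewrite /H !inE; case: (a \in A) => //=; case: leqP.
move=> h; rewrite -(leq_pmul2r B0).
rewrite [(8 * #|B| * _)%N]mulnAC in h; move: inv h.
by move: (#|A| * _)%N (8 * _ * _)%N => u v; lia.
Qed.

(** The centres [c] are arbitrary because the global mean of a position need not be its mean in the
    fiber; a variance is smallest about its own mean. *)
Lemma fiber_spread (mu L K : R) A B f0 : 0 < mu ->
  spreads mu L K ->
  mu_pair mu A B -> (0 < #|A|)%N -> (0 < #|B|)%N ->
  mu * #|A|%:R <= #|B|%:R -> K <= #|B|%:R -> linext f0 ->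
  (#|A| * #|B| <= 4 * inversions A B f0)%N ->
  forall c : P -> R,
  L * #|A|%:R <= (\sum_(f in fiber (down_closure A) f0)
    \sum_(a in A) (position R a f - c a) ^+ 2) / #|fiber (down_closure A) f0|%:R.
Proof.
move=> mu0 spread [AB max] A0 B0 muAB KB f0l inv c; set X := down_closure A.
have Xd := @down_closure_down A.
have par := height_parametrizes Xd f0l.
have /fintype.subsetP AX := sub_down_closure A.
pose rX := rank_in X (fun x => nat_of_ord (f0 x)).
have rXi : {in X &, injective rX}.
  by apply: rank_in_inj; exact: in2W (linext_inj f0l).
have high := many_high B0 inv; set H := [set a in A | _] in high.
have HA a : a \in H -> a \in A by rewrite inE => /andP[].
have [a1 a1H] : exists a, a \in H by apply/card_gt0P; lia.
(* The first high element for [f0] provides [i0], so that all high elements have indices from [i0]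
   on. *)
case: (@arg_minnP _ a1 (mem H) (fun a => nat_of_ord (f0 a)) a1H) => a0 a0H a0min.
have {}a0H : a0 \in H by [].
have a0X : a0 \in X by apply/AX/HA.
pose idx a := (rX a).+1.
have idx_uniq (S : {set P}) : S \subset X -> uniq [seq idx a | a <- enum S].
  move=> /fintype.subsetP SX; rewrite map_inj_in_uniq ?enum_uniq // => x y.
  by rewrite !mem_enum => xS yS [] /rXi; apply; apply: SX.
pose D i := i \in [seq idx a | a <- enum A].
have rXp a : a \in A -> (rX a < #|X|)%N by move=> aA; apply/rank_in_lt_card/AX.
have area i : (0 < i)%N -> (i <= #|X|)%N ->
    mu * ((#|X|.+1 - i)%:R * (barrier X f0 i)%:R) <= #|A|%:R * #|B|%:R.
  by move=> i0 iX; rewrite -(card_tail f0l i0 iX); apply/max/barrier_incomparable.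
(* The height of [f0] itself lies under the barrier, and at [a0] it counts at least an eighth of
   [B]. *)
have top : (#|B| <= 8 * barrier X f0 (idx a0))%N.
  move: a0H; rewrite inE => /andP[a0A hB]; apply: (leq_trans hB); rewrite leq_mul2l /=.
  have [_ _ hk _] := admissible_height (mem_fiber X f0l).
  apply: leq_trans (hk (idx a0)); apply: subset_leq_card; apply/fintype.subsetP => b.
  rewrite inE => /andP[bB ba]; have bX := incomparable_down_closure AB bB.
  rewrite inE finset.in_setC bX /=.
  rewrite ltnS leqNgt (below_gt (mem_fiber X f0l)) // -leqNgt; exact: ltnW.
have many : (#|A| <= 8 * count D (index_iota (idx a0) #|X|.+1))%N.
  apply: (leq_trans high); rewrite leq_mul2l /= cardE -(size_map idx) -size_filter.
  apply: uniq_leq_size => [|_ /mapP[a + ->]].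
    by apply: idx_uniq; apply/fintype.subsetP => a /HA/AX.
  rewrite mem_enum mem_filter mem_index_iota => aH.
  rewrite /D map_f ?mem_enum ?HA //= /idx !ltnS rXp ?HA // andbT.
  by apply: rank_in_mono; apply: a0min.
have := spread _ _ _ _ _ _ #|A| #|B| (idx a0) D par (@barrier_mono _ _ X f0)
  (barrier_le X f0) A0 area isT (rXp _ (HA _ a0H)) top many muAB KB.
move=> /le_trans; apply.
rewrite exchange_big mulr_suml /=.
apply: (@le_trans _ _ (\sum_(a in A) var R (fiber X f0) (height X) (idx a))).
  rewrite -big_filter -big_enum -(big_map idx predT) /=.
  apply: ler_sum_subset.
  - by rewrite filter_uniq // iota_uniq.
  - by apply: idx_uniq; apply/fintype.subsetP.
  - by move=> i; rewrite mem_filter => /andP[].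
  - by move=> i; apply: (Ex_ge0 par) => g _; apply: sqr_ge0.
apply: ler_sum => a aA.
apply: (le_trans (var_le par (idx a) (c a - (rX a).+1%:R))).
rewrite le_eqVlt; apply/orP; left; apply/eqP; congr (_ / _); apply: eq_bigr => f fF.
congr (_ ^+ 2); rewrite /position (position_in fF (AX _ aA)) -/(rX a) -/(idx a).
by rewrite -addSn natrD opprB addrCA addrA.
Qed.

Lemma sigma_sqr (x : P) : sigma R x ^+ 2 =
  (\sum_(f | linext f) (position R x f - linext_mean (position R x)) ^+ 2) / #|linext|%:R.
Proof.
by rewrite /sigma sqr_sqrtr // divr_ge0 // sumr_ge0 // => f _; apply: sqr_ge0.
Qed.

Lemma card_linext_gt0 : (0 < #|linext|)%N.
Proof. by have [f fl] := linext_exists P; apply/card_gt0P; exists f. Qed.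

Lemma inversions_le A B f : (inversions A B f <= #|A| * #|B|)%N.
Proof.
rewrite -sum_nat_const; apply: leq_sum => a _; apply: subset_leq_card.
by apply/fintype.subsetP => b; rewrite inE => /andP[].
Qed.

(** The same reverse Markov inequality over linear extensions: an average of one half leaves a
    quarter of them with a quarter of the pairs inverted. *)
Lemma many_inverted A B : (0 < #|A| * #|B|)%N ->
  (#|A| * #|B| * #|linext| <= 2 * \sum_(f | linext f) inversions A B f)%N ->
  (#|linext| <= 4 * #|[pred f | linext f & (#|A| * #|B| <= 4 * inversions A B f)%N]|)%N.
Proof.
set N := (#|A| * #|B|)%N => N0 half; set good := [pred f | _ & _].
have : (4 * \sum_(f | linext f) inversions A B f <=
    \sum_(f | linext f) (4 * N * (f \in good) + N))%N.
  rewrite big_distrr; apply: leq_sum => f fl; rewrite mulnbr inE fl /=.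
  case: (leqP N (4 * inversions A B f)) => h; last by rewrite add0n ltnW.
  by apply: leq_trans (leq_addr _ _); rewrite leq_mul2l inversions_le.
rewrite big_split /= -big_distrr /= sum_nat_const.
have -> : (\sum_(f | linext f) (f \in good) = #|good|)%N.
  rewrite -[RHS]sum1_card big_mkcond [RHS]big_mkcond /=; apply: eq_bigr => f _.
  by rewrite inE; case: (linext f) => //=; case: (_ <= _)%N.
have -> : #|[pred f | linext f]| = #|linext| by apply: eq_card.
move=> h; rewrite -(leq_pmul2l N0) mulnCA mulnA.
move: half h; rewrite [(#|linext| * N)%N]mulnC.
by move: (4 * N * _)%N (N * _)%N (\sum_(_ | _) _)%N => u v w; lia.
Qed.

End Inversions.

Lemma spread_one_sided (R : realType) (mu L : R) : 0 < mu ->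
  exists K : R, forall (d : Order.disp_t) (P : finPOrderType d) (A B : {set P}),
    mu_pair mu A B -> mu * #|A|%:R <= #|B|%:R -> K <= #|B|%:R ->
    (#|A| * #|B| * #|@linear_extension d P| <=
       2 * \sum_(f | linear_extension f) inversions A B f)%N ->
    L * #|A|%:R <= \sum_(x in A) sigma R x ^+ 2.
Proof.
(* Only a quarter of the [f0] are known to contribute, hence the factor 4. *)
move=> mu0; have [K spread] := @lattice_spread R mu (4 * `|L|) mu0.
exists (Num.max 1 K) => d P A B AB muAB; rewrite ge_max => /andP[B1 KB] half.
have [A0|A0] := posnP #|A|.
  by rewrite A0 mulr0 sumr_ge0 // => x _; apply: sqr_ge0.
have B0 : (0 < #|B|)%N by rewrite -(ler_nat R).
have N0 := card_linext_gt0 P.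
have N0' : 0 < #|@linear_extension d P|%:R :> R by rewrite ltr0n.
under eq_bigr do rewrite sigma_sqr.
rewrite -mulr_suml ler_pdivlMr // exchange_big /= (sum_fiber (down_closure A)).
set G := [pred f | linear_extension f & (#|A| * #|B| <= 4 * inversions A B f)%N].
have many : (#|@linear_extension d P| <= 4 * #|G|)%N.
  by apply: many_inverted half; rewrite muln_gt0 A0.
apply: (@le_trans _ _ (\sum_(f0 in G) (4 * `|L| * #|A|%:R))).
  rewrite sumr_const -[_ *+ #|G|]mulr_natr.
  apply: (@le_trans _ _ (`|L| * #|A|%:R * #|@linear_extension d P|%:R)).
    by rewrite ler_wpM2r // ler_wpM2r // ler_norm.
  have : #|@linear_extension d P|%:R <= 4 * #|G|%:R :> R by rewrite -natrM ler_nat.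
  move=> /(ler_wpM2l (mulr_ge0 (normr_ge0 L) (ler0n R #|A|))); lra.
rewrite big_mkcond [leRHS]big_mkcond /=; apply: ler_sum => f0 _.
rewrite inE; case: (boolP (linear_extension f0)) => //= f0l.
case: ifP => [inv|_].
  exact: (fiber_spread mu0 spread AB A0 B0 muAB KB f0l inv).
rewrite divr_ge0 // sumr_ge0 // => f _; rewrite sumr_ge0 // => a _; exact: sqr_ge0.
Qed.

(** * Reversal of linear extensions and the dual poset *)

Section Dual.
Variables (d : Order.disp_t) (P : finPOrderType d).
Implicit Types (f : {ffun P -> 'I_#|P|}) (A B : {set P}).

Definition reverse f : {ffun P^d -> 'I_#|{: P^d}|} := [ffun x => rev_ord (f x)].

Lemma reverse_bij : bijective reverse.
Proof.
exists (fun g : {ffun P^d -> 'I_#|{: P^d}|} => [ffun x : P => rev_ord (g x)] : {ffun P -> 'I_#|P|}).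
  by move=> f; apply/ffunP => x; rewrite !ffunE rev_ordK.
by move=> f; apply/ffunP => x; rewrite !ffunE rev_ordK.
Qed.

Lemma reverse_lt f x y : (reverse f x < reverse f y)%N = (f y < f x)%N.
Proof.
rewrite !ffunE /=; have := ltn_ord (f x); have := ltn_ord (f y).
by move: #|P| (nat_of_ord (f x)) (nat_of_ord (f y)) => n i j ? ?; apply/idP/idP; lia.
Qed.

Lemma linear_extension_reverse f : linear_extension (reverse f) = linear_extension f.
Proof.
congr (_ && _).
  apply/injectiveP/injectiveP => finj x y xy; apply: finj.
    by rewrite !ffunE xy.
  by move: xy; rewrite !ffunE => /rev_ord_inj.
apply/forallP/forallP => H x; apply/forallP => y; apply/implyP => xy.
  have := H y => /forallP/(_ x)/implyP/(_ xy).
  by rewrite leqNgt reverse_lt -leqNgt.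
have := H y => /forallP/(_ x)/implyP/(_ xy).
by rewrite [in X in _ -> X]leqNgt reverse_lt -leqNgt.
Qed.

Lemma sum_reverse (V : nmodType) (F : {ffun P^d -> 'I_#|{: P^d}|} -> V) :
  \sum_(g | linear_extension g) F g = \sum_(f | linear_extension f) F (reverse f).
Proof.
rewrite (reindex reverse) /=; last exact: onW_bij reverse_bij.
by apply: eq_bigl => f; rewrite linear_extension_reverse.
Qed.

Lemma card_linear_extension_dual : #|@linear_extension _ P^d| = #|@linear_extension _ P|.
Proof.
have := sum_reverse (fun=> 1%N : nat); rewrite !sum1_card => h.
exact: h.
Qed.

Variable R : realType.

Lemma position_reverse f x : position R x (reverse f) = #|P|.+1%:R - position R x f.
Proof.
have fx : (f x < #|P|)%N := ltn_ord (f x).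
by rewrite /position ffunE /= -natrB ?subSn // ltnW.
Qed.

Lemma sigma_dual (x : P) : @sigma _ P^d R x = sigma R x.
Proof.
rewrite /sigma; congr (Num.sqrt _).
have N0 : #|@linear_extension _ P|%:R != 0 :> R by rewrite pnatr_eq0 -lt0n card_linext_gt0.
have mean_dual : linext_mean (@position _ P^d R x) = #|P|.+1%:R - linext_mean (position R x).
  rewrite /linext_mean sum_reverse card_linear_extension_dual.
  under eq_bigr do rewrite position_reverse.
  by rewrite sumrB mulrBl sumr_const -[_ *+ #|_|]mulr_natr mulfK.
rewrite {1}/linext_mean [RHS]/linext_mean sum_reverse card_linear_extension_dual.
congr (_ / _); apply: eq_bigr => f _.
rewrite mean_dual position_reverse; ring.
Qed.

Lemma incomparable_pair_dual A B : @incomparable_pair _ P^d A B <-> @incomparable_pair _ P A B.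
Proof.
by split=> -[AB H]; split => // a b aA bB; have := H a b aA bB; rewrite /Order.comparable orbC.
Qed.

Lemma mu_pair_dual (mu : R) A B : @mu_pair _ P R mu A B -> @mu_pair _ P^d R mu A B.
Proof.
move=> [AB H]; split; first exact/incomparable_pair_dual.
by move=> C D /incomparable_pair_dual; apply: H.
Qed.

(** Each pair is inverted in exactly one of [f] and its reverse, so one of the two posets has at
    least half of the pairs inverted on average. *)
Lemma inversions_reverse A B f : incomparable_pair A B -> linear_extension f ->
  (@inversions _ P^d A B (reverse f) + inversions A B f)%N = (#|A| * #|B|)%N.
Proof.
move=> [AB _] fl; rewrite /inversions -big_split /= -sum_nat_const; apply: eq_bigr => a aA.
rewrite -(cardsID [set b | (f a < f b)%N] B); congr (_ + _)%N.
  by apply: eq_card => b; rewrite !inE reverse_lt.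
apply: eq_card => b; rewrite !inE -leqNgt [in RHS]leq_eqVlt andbC.
case: (boolP (b \in B)) => bB; last by rewrite !andbF.
rewrite !andbT; case: eqP => // /(linext_inj fl) ba.
by move/fintype.pred0P: AB => /(_ a); rewrite /= aA -ba bB.
Qed.

End Dual.

Theorem theorem3p1 (R : realType) (mu L : R) (mu_gt0 : 0 < mu) :
  exists K : R,
    forall (d : Order.disp_t) (P : finPOrderType d) (A B : {set P}),
      maximal_mu_pair mu A B ->
      Num.max (mu * #|A|%:R) K <= #|B|%:R ->
      L * #|A|%:R <= \sum_(x in A) sigma R x ^+ 2.
Proof.
have [K spread] := spread_one_sided L mu_gt0.
exists K => d P A B [AB _]; rewrite ge_max => /andP[muAB KB].
have [half|half] := leqP (#|A| * #|B| * #|@linear_extension d P|)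
    (2 * \sum_(f | linear_extension f) inversions A B f).
  exact: spread half.
have -> : \sum_(x in A) sigma R x ^+ 2 = \sum_(x in A) @sigma _ P^d R x ^+ 2.
  by apply: eq_bigr => x _; rewrite sigma_dual.
apply: (spread _ P^d A B (mu_pair_dual AB) muAB KB).
rewrite sum_reverse card_linear_extension_dual.
have : (\sum_(f | linear_extension f) @inversions _ P^d A B (reverse f) +
    \sum_(f | linear_extension f) inversions A B f =
    #|A| * #|B| * #|@linear_extension d P|)%N.
  rewrite -big_split /= [RHS]mulnC -sum_nat_const; apply: eq_bigr => f fl.
  by case: AB => AB _; exact: inversions_reverse.
by move: half; move: (_ * #|_|)%N (\sum_(_ | _) _)%N (\sum_(_ | _) _)%N => N u v; lia.
Qed.
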